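(* Let $G$ be a finite primitive group of the form $V\rtimes G_0$ with $V$ elementary abelian and $G_0$ acting irreducibly on $V$. Assume that $G_0$ is MP and that any two nontrivial elements $x,y$ of $V$ are such that $x$ is conjugate in $G$ to $y$ or to $y^{-1}$. Then either $G$ is MP, in which case $G$ is isomorphic to one of $C_2$, $C_3$, $S_3$, $A_4$, $\mathrm{AGL}(1,5)$, $C_7\rtimes C_3$, $\mathrm{AGL}(1,7)$, $M(9)$; or $G$ is isomorphic to one of $\mathrm{A\Gamma L}(1,4)\cong S_4$, $\mathrm{A\Gamma L}(1,8)$, $\mathrm{A\Gamma L}(1,9)$, $\mathrm{A\Gamma L}(1,16)$.
   Context: A group $G$ has the Magnus Property (MP) if whenever $x,y\in G$ have the same normal closure in $G$, $x$ is conjugate in $G$ to $y$ or to $y^{-1}$. A finite group is primitive if it has a maximal subgroup $M$ with $\bigcap_{g\in G}g^{-1}Mg=\{1\}$. $C_7\rtimes C_3$ is the semidirect product with respect to the nontrivial action; $\mathrm{AGL}(1,q)=\mathbb{F}_q\rtimes\mathbb{F}_q^*$; $\mathrm{A\Gamma L}(1,q)=\mathbb{F}_q\rtimes(\mathbb{F}_q^*\rtimes\mathrm{Aut}(\mathbb{F}_q))$. $M(9)=\mathbb{F}_3^2\rtimes Q_8$ where $Q_8=\langle i,j\rangle\le\mathrm{GL}(2,3)$ acts naturally with $i\mapsto\begin{pmatrix}0&2\\1&0\end{pmatrix}$, $j\mapsto\begin{pmatrix}1&1\\1&2\end{pmatrix}$. *)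

(* Defs.v *)
From HB Require Import structures.
From mathcomp Require Import all_boot all_order all_algebra all_fingroup all_solvable all_field.
Set Implicit Arguments. Unset Strict Implicit. Unset Printing Implicit Defensive.
Import GRing.Theory.

Local Open Scope group_scope.

Definition MP (gT : finGroupType) (G : {set gT}) : Prop :=
  forall x y, x \in G -> y \in G ->
    <<x ^: G>> = <<y ^: G>> -> x \in y ^: G \/ x \in y^-1 ^: G.

Definition primitive_group (gT : finGroupType) (G : {set gT}) : Prop :=
  exists M : {group gT}, maximal M G /\ gcore M G = 1.

Definition field_auts (F : finFieldType) : {set {perm F}} :=
  [set s : {perm F} | [forall x, forall y,
     (s (x + y)%R == (s x + s y)%R) && (s (x * y)%R == (s x * s y)%R)]].

Definition AGL1 (F : finFieldType) : {set {perm F}} :=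
  <<[set p : {perm F} | [exists a : F, exists b : F,
      (a != 0%R) && [forall x, p x == (a * x + b)%R]]]>>.

Definition AGammaL1 (F : finFieldType) : {set {perm F}} :=
  <<[set p : {perm F} | [exists a : F, exists b : F, exists s in field_auts F,
      (a != 0%R) && [forall x, p x == (a * s x + b)%R]]]>>.

Definition isog_AGL1 (gT : finGroupType) (G : {set gT}) (q : nat) : Prop :=
  exists F : finFieldType, #|F| = q /\ G \isog AGL1 F.
Definition isog_AGammaL1 (gT : finGroupType) (G : {set gT}) (q : nat) : Prop :=
  exists F : finFieldType, #|F| = q /\ G \isog AGammaL1 F.

Definition C7semiC3 : {set {perm 'F_7}} :=
  <<[set p : {perm 'F_7} | [exists a : 'F_7, exists b : 'F_7,
      (a ^+ 3 == 1)%R && [forall x, p x == (a * x + b)%R]]]>>.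

Definition mx22 (a b c d : 'F_3) : 'M['F_3]_2 :=
  \matrix_(i < 2, j < 2)
    (if (i : nat) == 0%N then (if (j : nat) == 0%N then a else b)
     else (if (j : nat) == 0%N then c else d)).
Definition Q8i : 'M['F_3]_2 := (mx22 0 2%:R 1 0)%R.
Definition Q8j : 'M['F_3]_2 := (mx22 1 1 1 2%:R)%R.
(* the subgroup <i,j> of GL(2,3), listed as {i^k j^l : k < 4, l < 2} *)
Definition Q8set : {set 'M['F_3]_2} :=
  [set (Q8i ^+ k * Q8j ^+ l)%R | k : 'I_4, l : 'I_2].
Definition M9 : {set {perm 'cV['F_3]_2}} :=
  <<[set p : {perm 'cV['F_3]_2} | [exists A in Q8set, exists b : 'cV['F_3]_2,
      [forall v, p v == (A *m v + b)%R]]]>>.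

(* Main.v *)
(** Every normal abelian subgroup of G0 acts semiregularly on V: the subgroups
    <<v ^: A>> are permuted transitively up to inversion, hence partition V into
    irreducible A-modules. So normal abelian subgroups of G0 are cyclic. The Magnus
    property then yields a cyclic normal A with 'C_G0(A) = A: otherwise there is a
    class 2 normal subgroup B > A with centre A and B / A a chief factor, and an
    element t of order prime to r acting nontrivially on B / A while centralising
    the order r subgroup B^`(1) = <[z]> has the same normal closure as t * z, though
    the orders differ; this forces B / A to be cyclic. Counting shows that A is
    irreducible on V, so V is a field F of order p ^ n on which A acts by
    multiplications, and G0 by maps x |-> b * s x with s a field automorphism. Now
    G0 / A is cyclic of order e in {1, 2, 3, 4, 6} dividing n, totient #|A| <= 2 e and
    #|F| - 1 divides 2 #|A| e, which leaves fifteen cases; three of them are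
    excluded by hand. G is MP exactly when G0 is semiregular on V: if x in G0 fixes
    v <> 1, then x and x * w have the same normal closure for every w in V. *)
Require Import Defs.
From HB Require Import structures.
From mathcomp Require Import all_boot all_order all_algebra all_fingroup all_solvable all_field all_character.
Set Implicit Arguments. Unset Strict Implicit. Unset Printing Implicit Defensive.
Import GRing.Theory.
Local Open Scope group_scope.

(** * The Magnus property *)

Section NormalClosure.
Variables (gT : finGroupType) (G : {group gT}).
Implicit Types (x y : gT) (N : {group gT}).

Lemma mem_nclosure x : x \in <<x ^: G>>.
Proof. exact: mem_gen (class_refl G x). Qed.

Lemma nclosure_norm x : G \subset 'N(<<x ^: G>>).
Proof. exact: norms_gen (class_norm x G). Qed.

Lemma nclosure_sub x N : x \in N -> G \subset 'N(N) -> <<x ^: G>> \subset N.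
Proof. by move=> xN nNG; rewrite gen_subG class_sub_norm. Qed.

Lemma nclosure_eq x y :
  x \in <<y ^: G>> -> y \in <<x ^: G>> -> <<x ^: G>> = <<y ^: G>>.
Proof.
by move=> xy yx; apply/eqP; rewrite eqEsubset !nclosure_sub ?nclosure_norm.
Qed.

Lemma mem_nclosureR x y : x \in G -> y \in G -> [~ x, y] \in <<x ^: G>>.
Proof.
by move=> xG yG; rewrite commgEl groupM ?groupV ?mem_gen ?class_refl ?memJ_class.
Qed.

Lemma MP_order x y : MP G -> x \in G -> y \in G ->
  <<x ^: G>> = <<y ^: G>> -> #[x] = #[y].
Proof.
by move=> mpG xG yG /mpG[] // /imsetP[z zG ->]; rewrite orderJ ?orderV.
Qed.

(** All generators have the same normal closure, and conjugacy in an abelian group is equality, so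
    every generator is [x] or [x^-1]. *)
Lemma MP_cyclic_totient : MP G -> cyclic G -> totient #|G| <= 2.
Proof.
move=> mpG cycG; have [x defG] := cyclicP cycG.
have /abelian_classP class1 := cyclic_abelian cycG.
have xG : x \in G by rewrite defG cycle_id.
have -> : #|G| = #[x] by rewrite defG.
rewrite totient_gen.
apply: (@leq_trans #|[set x; x^-1]|); last by rewrite cards2; case: eqP.
apply/subset_leq_card/subsetP=> y; rewrite inE /generator => /eqP exy.
have yG : y \in G by rewrite defG exy cycle_id.
have /(mpG _ _ yG xG) : <<y ^: G>> = <<x ^: G>> by rewrite !class1.
by rewrite !class1 ?groupV // !inE => -[] ->; rewrite ?orbT.
Qed.

End NormalClosure.

Lemma quotient_nclosure (gT : finGroupType) (G N : {group gT}) x :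
  G \subset 'N(N) -> x \in G ->
  <<coset N x ^: (G / N)>> = <<x ^: G>> / N.
Proof.
move=> nNG xG; have xN := subsetP nNG x xG.
rewrite !quotientE morphim_gen ?morphim_class //.
by rewrite class_sub_norm // (subset_trans _ (normG _)) // normsG.
Qed.

(* Among the lifts of x, one whose normal closure is smallest has the same
   normal closure as some lift of y. *)
Lemma MP_quotient (gT : finGroupType) (G N : {group gT}) :
  N <| G -> MP G -> MP (G / N).
Proof.
move=> nsNG mpG X Y XG YG eXY.
have [sNG nNG] := andP nsNG.
pose Q x := (x \in G) && (coset N x == X).
have [x0 Qx0] : exists x, Q x.
  by have /morphimP[x _ xG eX] := XG; exists x; rewrite /Q xG eX eqxx.
have [x /andP[xG /eqP defX] minx] := arg_minnP (fun x => #|<<x ^: G>>|) Qx0.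
have sG z : z \in G -> <<z ^: G>> \subset G by move=> zG; rewrite nclosure_sub ?normG.
have : Y \in <<x ^: G>> / N.
  by rewrite -quotient_nclosure // defX eXY mem_nclosure.
case/morphimP=> y _ yx defY; have yG := subsetP (sG x xG) y yx.
(* A second lift [z] of [X] is found inside the normal closure of [y]; minimality of [x] then
   squeezes the three closures into equality. *)
have : X \in <<y ^: G>> / N.
  by rewrite -quotient_nclosure // -defY -eXY mem_nclosure.
case/morphimP=> z _ zy defz; have zG := subsetP (sG y yG) z zy.
have syx : <<y ^: G>> \subset <<x ^: G>> by rewrite nclosure_sub ?nclosure_norm.
have szy : <<z ^: G>> \subset <<y ^: G>> by rewrite nclosure_sub ?nclosure_norm.
have /(mpG _ _ xG yG) : <<x ^: G>> = <<y ^: G>>.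
  apply/esym/eqP; rewrite eqEcard syx (leq_trans _ (subset_leq_card szy)) //.
  by apply: minx; rewrite /Q zG -defz eqxx.
rewrite -defX defY; have nN := subsetP nNG.
case=> /imsetP[g gG ->]; [left | right; rewrite -morphV ?nN //];
  by rewrite morphJ ?groupV ?nN // memJ_class ?mem_quotient.
Qed.

Lemma minnormal_nclosure (gT : finGroupType) (G N : {group gT}) x :
  minnormal N G -> x \in N^# -> <<x ^: G>> = N.
Proof.
case/mingroupP=> /andP[ntN nNG] minN /setD1P[ntx xN].
apply: minN; last by rewrite nclosure_sub.
rewrite nclosure_norm andbT; apply: contraNneq ntx => c1.
by apply/eqP/set1gP; rewrite -c1 mem_nclosure.
Qed.

(** Every nontrivial element of [N] has normal closure [N], so all have one common order, a prime
    [p]. Thus [N] is a [p]-group, and its nontrivial centre is all of [N] by minimality. *)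
Lemma MP_minnormal_abelian (gT : finGroupType) (G N : {group gT}) :
  MP G -> N \subset G -> minnormal N G -> abelian N.
Proof.
move=> mpG sNG minNG; have clo := minnormal_nclosure minNG.
have [/andP[ntN nNG] minN] := mingroupP minNG.
have [x1 x1N ntx1] := trivgPn _ ntN.
have ord x : x \in N^# -> #[x] = #[x1].
  move=> xN1; have [ntx xN] := setD1P xN1.
  by apply: (MP_order mpG); rewrite ?(subsetP sNG) // ?clo // !inE ntx1.
have [p p_pr pN] : exists2 p, prime p & p %| #|N|.
  by exists (pdiv #|N|); rewrite ?pdiv_dvd ?pdiv_prime ?cardG_gt1.
have [y yN oy] := Cauchy p_pr pN.
have pG : p.-group N.
  apply/pgroupP=> r r_pr rN; have [z zN oz] := Cauchy r_pr rN.
  have nt u : prime #[u] -> u != 1 by rewrite -order_gt1 => /prime_gt1.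
  rewrite !inE -oz ord ?inE ?zN ?nt ?oz // -oy -(ord y) ?inE ?yN ?nt ?oy //.
have nZ : 'Z(N) = N.
  apply: minN; rewrite ?center_sub // center_nil_eq1 ?(pgroup_nil pG) // ntN.
  by rewrite (char_norm_trans (center_char N)).
by rewrite -nZ center_abelian.
Qed.

(** By coprimality [t] is a power of [t * z], so both have the same normal closure; equality of
    their orders leaves order 1 for [z]. *)
Lemma MP_coprime_cent (gT : finGroupType) (G : {group gT}) t z :
  MP G -> t \in G -> z \in G -> commute t z -> coprime #[t] #[z] ->
  z \in <<t ^: G>> -> z = 1.
Proof.
move=> mpG tG zG ctz cotz zt; have tzG : t * z \in G by rewrite groupM.
have: <<t ^: G>> = <<(t * z) ^: G>>.
  apply: nclosure_eq; last by rewrite groupM ?mem_nclosure.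
  have := cycleMsub ctz cotz; rewrite cycle_subG; apply: subsetP.
  by rewrite cycle_subG mem_nclosure.
move/(MP_order mpG tG tzG)/eqP; rewrite orderM // -{1}[#[t]]muln1.
by rewrite eqn_pmul2l ?order_gt0 // eq_sym order_eq1 => /eqP.
Qed.

(** As r'-elements act trivially on [W], [T] is the product of ['C_T(W)] and a Sylow r-subgroup [P].
    The normal subgroup [W] of [P] meets the centre of [P] nontrivially, and what lies there is
    fixed by both factors. *)
Lemma pcentral_fix (gT : finGroupType) (r : nat) (T W : {group gT}) :
  W <| T -> r.-group W -> W :!=: 1 ->
  {in T, forall t, r^'.-elt t -> t \in 'C(W)} -> 'C_W(T) != 1.
Proof.
move=> nsWT rW ntW cW; have [sWT nWT] := andP nsWT.
have [P sylP] := Sylow_exists r T; have sPT := pHall_sub sylP.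
have rP := pHall_pgroup sylP.
have sWP : W \subset P := normal_sub_max_pgroup (Hall_max sylP) rW nsWT.
have nCT : T \subset 'N('C_T(W)) by rewrite normsI ?normG ?norms_cent.
have rTC : r.-group (T / 'C_T(W)).
  apply/pgroupP=> s s_pr /(Cauchy s_pr)[_ /morphimP[x nx xT ->] os].
  have: r.-elt (coset 'C_T(W) x).
    rewrite -[x](consttC r) morphM; last 2 first.
    - by rewrite (subsetP nCT) ?groupX.
    - by rewrite (subsetP nCT) ?groupX.
    have xC : x.`_r^' \in 'C_T(W) by rewrite inE groupX //= cW ?groupX ?p_elt_constt.
    rewrite /= (coset_id xC) mulg1 morph_p_elt ?p_elt_constt //.
    by rewrite (subsetP nCT) ?groupX.
  by rewrite /p_elt os pnatE.
have defT : T \subset 'C_T(W) * P.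
  rewrite -quotientSK //; have sylPC := quotient_pHall (subset_trans sPT nCT) sylP.
  by rewrite (pHall_id sylPC rTC).
have := meet_center_nil (pgroup_nil rP) (_ : W <| P) ntW.
rewrite (normalS sWP sPT) // => /(_ isT); apply: contra => /eqP c1.
rewrite -subG1 -c1; apply/subsetP=> w /setIP[wW /setIP[wP wCP]].
rewrite inE wW; apply/centP=> t /(subsetP defT)/mulsgP[c q /setIP[_ cc] qP ->].
apply: commuteM; first by apply: commute_sym; apply: (centP cc).
exact: (centP wCP).
Qed.

Lemma MP_selfcentralizing (gT : finGroupType) (G : {group gT}) :
  MP G -> (forall A : {group gT}, A <| G -> abelian A -> cyclic A) ->
  exists A : {group gT}, [/\ A <| G, cyclic A & 'C_G(A) = A].
Proof.
move=> mpG cyc.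
pose gP (A : {group gT}) := (A <| G) && abelian A.
have gP1 : gP 1%G by rewrite /gP normal1 abelian1.
have [A /maxgroupP[/andP[nsAG abA] maxA] _] := maxgroup_exists gP1.
have cycA := cyc A nsAG abA; have [sAG nAG] := andP nsAG.
exists A; split=> //; apply/eqP; rewrite eqEsubset andbC subsetI sAG [A \subset 'C(A)]abA /=.
apply: contraT => nCA.
have nCG : G \subset 'N('C_G(A)) by rewrite normsI ?normG ?norms_cent.
have nAC : 'C_G(A) \subset 'N(A) by rewrite subIset ?nAG.
have ntCA : ('C_G(A) / A)%G != 1 :> {set _} by rewrite -subG1 quotient_sub1.
(* [A] is a maximal normal abelian subgroup. If it is not self-centralising, choose a minimal normal
   subgroup [Bq = B / A] of [G / A] inside ['C_G(A) / A]; the goal is to show that [B] is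
   abelian. *)
have [Bq minB sBC] := minnormal_exists ntCA (quotient_norms A nCG).
have [/andP[ntB nBG] minBq] := mingroupP minB.
have mpGq := MP_quotient nsAG mpG.
have nsBq : Bq <| G / A.
  by rewrite /normal nBG (subset_trans sBC) ?quotientS ?subsetIl.
have [B defB sAB nsBG] := inv_quotientN nsAG nsBq.
have [sBG nBGG] := andP nsBG; have nAB := subset_trans sBG nAG.
have cAB : B \subset 'C(A).
  rewrite defB quotientSGK // in sBC; first by apply: subset_trans sBC (subsetIr _ _).
  by rewrite subsetI sAG.
have abBq := MP_minnormal_abelian mpGq (normal_sub nsBq) minB.
have [_ _ /is_abelemP[r r_pr abelB]] :=
  minnormal_solvable minB (subxx _) (abelian_sol abBq).
have nabB : ~~ abelian B.
  apply: contra ntB => abB; rewrite defB (_ : B :=: A) ?trivg_quotient //.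
  by apply: maxA => //; apply/andP.
have ZB : 'Z(B) = A.
  apply: maxA; last by rewrite subsetI sAB centsC.
  by rewrite /gP center_abelian andbT (char_normal_trans (center_char B)).
have comA x y : x \in B -> y \in B -> [~ x, y] \in A.
  move=> xB yB; apply: (subsetP _ _ (mem_commg xB yB)).
  by rewrite -quotient_cents2 // -defB.
(* Commutators are central, so the power equals [[~ x ^+ r, y]], and [x ^+ r] lies in [A], which [B]
   centralises. *)
have comr x y : x \in B -> y \in B -> [~ x, y] ^+ r = 1.
  move=> xB yB; have cA u v : u \in B -> v \in A -> commute u v.
    by move=> uB; apply/centP; apply: (subsetP cAB).
  rewrite -commXg; last by apply: cA => //; apply: comA.
  apply/eqP/commgP; apply: commute_sym; apply: cA => //.
  apply: coset_idr; first by rewrite groupX // (subsetP nAB).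
  rewrite morphX ?(subsetP nAB) //.
  by case/(abelemP r_pr): abelB => _ -> //; rewrite defB mem_quotient.
have nc x : x \in B -> x \notin A -> exists2 y, y \in B & [~ x, y] != 1.
  move=> xB nAx; apply/exists_inP; apply: contraR nAx => /exists_inPn H.
  by rewrite -ZB inE xB; apply/centP=> y yB; apply/commgP; apply: negbNE (H y yB).
have [x0 x0B x0A] : exists2 x, x \in B & x \notin A.
  by apply/subsetPn; apply: contra nabB => sBA; apply: abelianS abA.
have [y0 y0B] := nc x0 x0B x0A; set z := [~ x0, y0] => ntz.
have zA : z \in A by apply: comA.
have oz : #[z] = r by apply: nt_prime_order => //; apply: comr.
(* The cyclic group [A] has only one subgroup of order [r]. *)
have zuniq x y : x \in B -> y \in B -> [~ x, y] != 1 -> z \in <[[~ x, y]]>.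
  move=> xB yB nt; have ox := nt_prime_order r_pr (comr x y xB yB) nt.
  have /eqP<- : <[z]>%G :==: <[[~ x, y]]>%G.
    by rewrite (eq_subG_cyclic cycA) ?cycle_subG ?comA // -!orderE ox oz.
  exact: cycle_id.
have nzG : G \subset 'N(<[z]>).
  apply: (char_norm_trans _ nAG).
  by rewrite sub_cyclic_char // cycle_subG.
pose T := 'C_G(<[z]>)%G.
have nsTG : T <| G by rewrite /normal subsetIl normsI ?normG ?norms_cent.
have [sTG nTG] := andP nsTG.
have sBT : B \subset T.
  by rewrite subsetI sBG (subset_trans cAB) // centS // cycle_subG.
(* Otherwise [[~ t, b]] is not central in [B]. Its commutator with a suitable [y'] generates
   [<[z]>], which puts [z] in the normal closure of [t], against [MP_coprime_cent]. *)
have cT t b : t \in T -> r^'.-elt t -> b \in B -> [~ t, b] \in A.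
  move=> tT r't bB; have tG := subsetP sTG t tT; have bG := subsetP sBG b bB.
  apply: contraT => nAy.
  have yB : [~ t, b] \in B by rewrite commgEr groupM // memJ_norm ?groupV // (subsetP nBGG).
  have [y' y'B nty] := nc _ yB nAy.
  suff z1 : z = 1 by rewrite z1 eqxx in ntz.
  apply: (MP_coprime_cent mpG tG (subsetP sAG z zA)).
  - by apply: (centP (subsetP (subsetIr _ _) t tT)); apply: cycle_id.
  - by rewrite oz coprime_sym prime_coprime // -p'natE.
  have := zuniq _ _ yB y'B nty; apply: subsetP; rewrite cycle_subG commgEl.
  have yN := mem_nclosureR tG bG.
  by rewrite groupM ?groupV // memJ_norm // (subsetP (nclosure_norm G t)) ?(subsetP sBG).
have nAT := subset_trans sTG nAG.
have sBTq : Bq \subset T / A by rewrite defB quotientS.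
have nsBTq : Bq <| T / A.
  by rewrite /normal sBTq (subset_trans (quotientS A sTG)).
have fixq : 'C_Bq(T / A) != 1.
  apply: (pcentral_fix nsBTq (abelem_pgroup abelB) ntB) => tq tTq r'tq.
  rewrite -(constt_p_elt r'tq); case/morphimP: tTq => t nt tT ->.
  have ntr : t.`_r^' \in 'N(A) by rewrite groupX.
  rewrite -morph_constt //; apply/centP=> bq; rewrite defB.
  case/morphimP=> b nb bB ->; apply/commgP; rewrite -morphR //=.
  by rewrite coset_id // cT ?groupX ?p_elt_constt.
have cBT : Bq \subset 'C(T / A).
  apply/setIidPl; apply: minBq; last exact: subsetIl.
  by rewrite fixq normsI // norms_cent // quotient_norms.
(* The index counts the conjugates of [z], all among the [r - 1] nontrivial elements of [<[z]>]. *)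
have leGT : #|G : T| < r.
  rewrite /= cent_cycle index_cent1 -oz orderE (cardsD1 1 <[z]>) group1 add1n ltnS.
  apply: subset_leq_card; rewrite class_sub_norm ?inE ?ntz ?cycle_id //.
  by rewrite normD1.
have leB y : y \in Bq -> #|y ^: (G / A)| < r.
  move=> yB; apply: leq_ltn_trans leGT; rewrite -index_cent1.
  have <- : #|G / A : T / A| = #|G : T|.
    by rewrite index_quotient_eq // setIC subIset // (subset_trans sAB).
  apply: dvdn_leq => //; apply: indexgS; rewrite subsetI quotientS //=.
  by rewrite sub_cent1 (subsetP cBT).
have [y yB nty] := trivgPn _ ntB.
(* By the Magnus property of [G / A], [Bq] is covered by 1 and the classes of [y] and [y^-1], each
   of size at most [r - 1]. The bound is below [r ^ 2], so [Bq] has order [r]. *)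
have leBr : #|Bq| <= (r + r.-1).
  have sB : Bq \subset (1 |: y ^: (G / A)) :|: y^-1 ^: (G / A).
    apply/subsetP=> u uB; rewrite !inE; have [//|ntu] := eqVneq u 1.
    have clo v : v \in Bq -> v != 1 -> <<v ^: (G / A)>> = Bq.
      by move=> vB ntv; apply: minnormal_nclosure; rewrite ?inE ?ntv.
    have sBG' := subsetP (normal_sub nsBq).
    have [] := mpGq _ _ (sBG' u uB) (sBG' y yB); first by rewrite !clo.
      by move=> ->; rewrite orbT.
    by move=> ->; rewrite orbT.
  apply: leq_trans (subset_leq_card sB) _; apply: leq_trans (leq_card_setU _ _) _.
  apply: leq_add; last by rewrite -ltnS prednK ?prime_gt0 // leB ?groupV.
  by rewrite cardsU1 (leq_trans (leq_add (leq_b1 _) (leqnn _))) // add1n leB.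
have cycB : cyclic Bq.
  have [k ck] := p_natP (abelem_pgroup abelB); case: k ck => [|[|k]] ck.
  - by move/eqP: ck; rewrite -trivg_card1 (negPf ntB).
  - by rewrite prime_cyclic // ck.
  move: leBr; rewrite leqNgt => /negP[]; rewrite ck (@leq_trans (r ^ 2)) //.
    have r2 := prime_gt1 r_pr; rewrite -mulnn (@leq_trans (2 * r)) ?leq_mul2r ?r2 ?orbT //.
    by rewrite mul2n -addnn ltn_add2l ltn_predL prime_gt0.
  by rewrite (leq_exp2l _ _ (prime_gt1 r_pr)).
case/negP: nabB; apply: (cyclic_factor_abelian _ (_ : cyclic (B / A))).
  by rewrite ZB.
by rewrite -defB.
Qed.

(** * Transitivity up to inversion *)

Section PlusMinusTransitive.
Variables (gT : finGroupType) (V G0 : {group gT}).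
Hypothesis nVG : G0 \subset 'N(V).
Variable p : nat.
Hypothesis abelV : p.-abelem V.
Let abV := abelem_abelian abelV.
Hypothesis ffulG : 'C_G0(V) = 1.
Hypothesis pmtr : {in V^# &, forall x y, x \in y ^: G0 \/ x \in y^-1 ^: G0}.

Section NormalSubgroup.
Variable A : {group gT}.
Hypothesis nsAG : A <| G0.
Let sAG := normal_sub nsAG.
Let nAG := normal_norm nsAG.
Let nVA := subset_trans sAG nVG.

Lemma orbit_gen_sub v : v \in V -> <<v ^: A>> \subset V.
Proof. by move=> vV; apply: nclosure_sub. Qed.

Lemma orbit_genJ v g : g \in G0 -> <<(v ^ g) ^: A>> = <<v ^: A>> :^ g.
Proof.
move=> gG; rewrite -genJ; congr <<_>>.
apply/setP=> x; rewrite mem_conjg; apply/imsetP/imsetP=> [[a aA ->] | [a aA e]].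
  exists (a ^ g^-1); first by rewrite memJ_norm ?groupV // (subsetP nAG).
  by rewrite -!conjgM; congr (v ^ _); rewrite conjgE invgK !mulgA.
exists (a ^ g); first by rewrite memJ_norm // (subsetP nAG).
by rewrite -conjgM -conjgC conjgM -e conjgKV.
Qed.

Lemma orbit_genV v : <<v^-1 ^: A>> = <<v ^: A>>.
Proof.
apply: nclosure_eq; last by rewrite -[X in X \in _]invgK groupV mem_nclosure.
by rewrite groupV mem_nclosure.
Qed.

(** [G0] permutes these subgroups because it normalises [A], and replacing a generator by its
    inverse does not change them. *)
Lemma card_orbit_gen x y : x \in V^# -> y \in V^# -> #|<<x ^: A>>| = #|<<y ^: A>>|.
Proof.
move=> xV yV; case: (pmtr xV yV) => /imsetP[g gG ->];
by rewrite orbit_genJ // cardJg ?orbit_genV.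
Qed.

(* All the subgroups <<v ^: A>> have the same order, so they are minimal
   A-invariant subgroups and partition V. *)
Lemma orbit_gen_eq v w : v \in V -> w \in <<v ^: A>> -> w != 1 ->
  <<w ^: A>> = <<v ^: A>>.
Proof.
move=> vV wv ntw; have wV := subsetP (orbit_gen_sub vV) w wv.
have ntv : v != 1.
  apply: contraNneq ntw => v1; move: wv; rewrite v1 class1G genGid.
  by move/set1gP->.
apply/eqP; rewrite eqEcard nclosure_sub ?nclosure_norm //=.
by rewrite (@card_orbit_gen w v) ?inE ?ntw ?ntv.
Qed.

(** If [a] fixes [v], it fixes [<<v ^: A>>] pointwise, [A] being abelian. Were [u] moved, then
    [[~ v * u, a] = [~ u, a]] would lie in the subgroups of both [v * u] and [u]. These then
    coincide and contain [v], so [a] would fix [u]. Hence [a] centralises [V], and faithfulness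
    applies. *)
Lemma abelian_normal_semiregular : abelian A -> semiregular V A.
Proof.
move=> abA a /setD1P[nta aA]; apply/eqP; apply: contraR nta.
case/trivgPn=> v /setIP[vV /cent1P cav] ntv.
have fixU u : u \in V -> commute u a -> <<u ^: A>> \subset 'C[a].
  move=> uV cau; rewrite gen_subG; apply/subsetP=> _ /imsetP[b bA ->].
  apply/cent1P; apply/commgP/conjg_fixP; rewrite -conjgM.
  have cab : commute a b by apply: (centsP abA).
  rewrite -cab conjgM (_ : u ^ a = u) //.
  exact/conjg_fixP/commgP.
suff: a \in 'C_G0(V) by rewrite ffulG => /set1gP->.
rewrite inE (subsetP sAG) //=; apply/centP=> u uV.
apply/cent1P; apply: contraT => nfu.
have ntc : [~ u, a] != 1.
  by apply: contra nfu => /commgP cua; apply/cent1P/commute_sym.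
pose w := v * u.
have wV : w \in V by rewrite groupM.
have cw : [~ w, a] = [~ u, a].
  by rewrite commMgJ (eqP (introT commgP cav)) conj1g mul1g.
have inU x : x \in V -> [~ x, a] \in <<x ^: A>>.
  move=> xV; rewrite commgEl; apply: groupM; first by rewrite groupV mem_nclosure.
  by rewrite mem_gen // memJ_class.
have eUw : <<w ^: A>> = <<u ^: A>>.
  rewrite -(orbit_gen_eq wV (inU w wV)) cw // -(orbit_gen_eq uV (inU u uV)) //.
have vU : v \in <<u ^: A>>.
  have wU : w \in <<u ^: A>> by rewrite -eUw mem_nclosure.
  by rewrite -[v](mulgK u) groupM ?groupV ?mem_nclosure.
case/negP: nfu; rewrite cent1C; have := fixU v vV cav.
by rewrite (orbit_gen_eq uV vU ntv) => /subsetP->; rewrite ?mem_nclosure.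
Qed.

(** [<<v ^: A>>] is an irreducible [A]-module, faithful by semiregularity, and an abelian group with
    a faithful irreducible representation is cyclic. *)
Lemma abelian_normal_cyclic : V :!=: 1 -> abelian A -> cyclic A.
Proof.
case/trivgPn=> v vV ntv abA; have regA := abelian_normal_semiregular abA.
pose U := <<v ^: A>>%G; have sUV : U \subset V := orbit_gen_sub vV.
have vU : v \in U := mem_nclosure A v.
have ntU : U :!=: 1 by apply/trivgPn; exists v.
have nUA : A \subset 'N(U) := nclosure_norm A v.
have abelU := abelemS sUV abelV.
apply: (@mx_faithful_irr_abelian_cyclic _ _ _ _ (abelem_repr abelU ntU nUA)) => //.
  apply: abelem_mx_faithful; apply/trivgP/subsetP=> a /setIP[aA /centP caU].
  apply: contraR ntv => nta; have nta1 : a != 1 by apply: contraNneq nta => ->.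
  have := regA a; rewrite in_setD1 nta1 aA => /(_ isT) C1.
  apply/eqP/set1gP; rewrite -C1 inE vV; apply/cent1P/commute_sym/caU.
  exact: vU.
apply/abelem_mx_irrP/mingroupP; split=> [|H /andP[ntH nHA] sHU]; first by rewrite ntU.
have [w wH ntw] := trivgPn _ ntH; apply/eqP; rewrite eqEsubset sHU /=.
by rewrite -(orbit_gen_eq vV (subsetP sHU w wH) ntw) nclosure_sub.
Qed.

(* The translates of U = <<v ^: A>> cover V, and there are at most
   |G0 : A| <= |A| < |U| of them, whereas |V| >= |U|^2 if U <> V. *)
Lemma selfcent_irreducible : cyclic A -> 'C_G0(A) = A -> {in V^#, forall v, <<v ^: A>> = V}.
Proof.
move=> cycA CA v /setD1P[ntv vV].
have regA := abelian_normal_semiregular (cyclic_abelian cycA).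
pose U := <<v ^: A>>%G; have sUV : U \subset V := orbit_gen_sub vV.
have nUA : A \subset 'N(U) := nclosure_norm A v.
have regU : semiregular U A.
  by move=> a aA; apply/trivgP; rewrite -(regA a aA) setSI.
have ltAU : #|A| < #|U|.
  have U1 : 1 < #|U|.
    by rewrite cardG_gt1; apply/trivgPn; exists v; rewrite ?mem_nclosure.
  rewrite -(ltn_predK U1) ltnS; apply: dvdn_leq (regular_norm_dvd_pred nUA regU).
  by rewrite -ltnS (ltn_predK U1).
have [a defA] := cyclicP cycA.
(* Since [A] is generated by [a] and self-centralising, this index is the size of the class of [a],
   which stays inside [A]. *)
have leGA : #|G0 : A| <= #|A|.
  rewrite -[X in #|G0 : X|]CA defA cent_cycle index_cent1 subset_leq_card //.
  by rewrite class_sub_norm -?defA //= defA cycle_id.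
have leV : #|V| <= (#|A| * #|U|.-1).+1.
  have sV : V \subset 1 |: cover (U^# :^: G0).
    apply/subsetP=> x xV; rewrite in_setU1; have [//|ntx] := eqVneq x 1.
    have U1 u : u \in U -> u != 1 -> forall g, u ^ g \in U^# :^ g.
      by move=> uU ntu g; rewrite memJ_conjg !inE ntu.
    have vU : v \in U := mem_nclosure A v.
    rewrite orFb; apply/bigcupP.
    case: (pmtr (_ : x \in V^#) (_ : v \in V^#)); rewrite ?inE ?ntx ?ntv //.
      by case/imsetP=> g gG ->; exists (U^# :^ g); rewrite ?imset_f ?U1.
    by case/imsetP=> g gG ->; exists (U^# :^ g); rewrite ?imset_f ?U1 ?groupV ?eq_invg1.
  apply: leq_trans (subset_leq_card sV) _; apply: leq_trans (leq_card_setU _ _) _.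
  rewrite cards1 add1n ltnS.
  apply: leq_trans (leq_card_cover _) _.
  have -> : \sum_(B in U^# :^: G0) #|B| =
            (#|U^# :^: G0| * #|U|.-1)%N.
    rewrite -sum_nat_const; apply: eq_bigr => _ /imsetP[g _ ->].
    by rewrite cardJg (cardsD1 1 U) group1.
  rewrite leq_mul2r; apply/orP; right; apply: leq_trans leGA.
  rewrite card_conjugates; apply: dvdn_leq => //; apply: indexgS.
  by rewrite subsetI sAG; apply: normsD1.
apply/eqP; rewrite eqEsubset sUV /=; apply: contraT => /subsetPn[w wV nUw].
have ntw : w != 1 by apply: contraNneq nUw => ->.
pose W := <<w ^: A>>%G; have sWV : W \subset V := orbit_gen_sub wV.
have tiUW : U :&: W = 1.
  apply/trivgP/subsetP=> x /setIP[xU xW]; apply: contraR nUw => ntx.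
  have eU : <<v ^: A>> = <<x ^: A>> by rewrite (orbit_gen_eq vV xU) // -in_set1.
  by rewrite /= eU (orbit_gen_eq wV xW) ?mem_nclosure // -in_set1.
have cUW : #|W| = #|U| by apply: card_orbit_gen; rewrite !inE ?ntw ?ntv.
have : #|U| * #|U| <= #|V|.
  by rewrite -{2}cUW -TI_cardMg // subset_leq_card // mul_subG.
rewrite leqNgt; case/negP; apply: leq_ltn_trans leV _.
have : 1 < #|U| by apply: leq_ltn_trans ltAU; apply: cardG_gt0.
case: #|U| ltAU => // u; rewrite ltnS => leAu u_gt0 /=.
rewrite mulSn addSn ltnS (leq_ltn_trans (_ : _ <= u * u)) ?leq_mul2r ?leAu ?orbT //.
rewrite mulnS addnA -[X in X < _]add0n ltn_add2r addn_gt0.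
by rewrite ltnS in u_gt0; rewrite u_gt0.
Qed.

End NormalSubgroup.
End PlusMinusTransitive.

(** * The field structure on [V] *)

Import MatrixGenField.

Lemma orbit_gen_minnormal (gT : finGroupType) (V A : {group gT}) :
  A \subset 'N(V) -> V :!=: 1 -> {in V^#, forall v, <<v ^: A>> = V} -> minnormal V A.
Proof.
move=> nVA ntV irrA; apply/mingroupP; rewrite ntV; split=> // H /andP[ntH nHA] sHV.
have [w wH ntw] := trivgPn _ ntH; apply/eqP; rewrite eqEsubset sHV /=.
by rewrite -(irrA w) ?nclosure_sub // !inE ntw (subsetP sHV).
Qed.

(** By Schur's lemma the polynomials in the matrix of a generator [a0] form a field [F]. The map [h]
    applies an element of [F] to a fixed vector: it is injective since nonzero elements are
    invertible, and onto since its image contains the orbit of that vector, which generates [V]. *)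
Lemma cyclic_field_model (gT : finGroupType) p (V A : {group gT}) :
  p.-abelem V -> V :!=: 1 -> A \subset 'N(V) -> cyclic A ->
  {in V^#, forall v, <<v ^: A>> = V} ->
  exists (F : finFieldType) (h : F -> gT) (c : gT -> F),
    [/\ injective h, h @: setT = V, {morph h : x y / (x + y)%R >-> x * y} &
        {in A, forall a, c a != 0%R /\ forall x, h x ^ a = h (c a * x)%R}].
Proof.
move=> abelV ntV nVA cycA irrA.
have minV := orbit_gen_minnormal nVA ntV irrA.
have [v vV ntv] := trivgPn _ ntV.
pose rA := abelem_repr abelV ntV nVA.
have irr_rA : mx_irreducible rA by apply/abelem_mx_irrP.
have [a0 defA] := cyclicP cycA.
have a0A : a0 \in A by rewrite defA cycle_id.
have cycle_a0 a : a \in A -> exists k, a = a0 ^+ k.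
  by rewrite defA => /cycleP.
have cGA : centgmx rA (rA a0).
  apply/centgmxP=> a aA; rewrite -!repr_mxM //; congr (rA _).
  by apply: (centsP (cyclic_abelian cycA)).
pose F := gen_of irr_rA cGA.
pose w := abelem_rV abelV ntV v.
pose h (x : F) : gT := rVabelem abelV ntV (w *m mxval x)%R.
have hD : {morph h : x y / (x + y)%R >-> x * y}.
  by move=> x y; rewrite /h raddfD /= mulmxDr rVabelemD.
have h1 : h 1%R = v by rewrite /h mxval1 mulmx1 abelem_rV_K.
have h0 : h 0%R = 1 by apply: (mulgI (h 0%R)); rewrite -hD addr0 mulg1.
have hN x : h (- x)%R = (h x)^-1.
  by apply: (mulgI (h x)); rewrite -hD subrr h0 mulgV.
have hV x : h x \in V by apply: mem_rVabelem.
pose gr : F := groot irr_rA cGA.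
have hgr x : h x ^ a0 = h (x * gr)%R.
  by rewrite /h mxvalM mulmxA mxval_groot rVabelemJ.
have hX x k : h x ^ (a0 ^+ k) = h (x * gr ^+ k)%R.
  elim: k x => [|k IHk] x; first by rewrite expr0 mulr1 conjg1.
  by rewrite expgS conjgM hgr IHk exprS mulrA.
have gr0 : gr != 0%R.
  apply: contraNneq ntv => g0; have := hgr 1%R; rewrite g0 mulr0 h0 h1.
  by move/eqP; rewrite conjg_eq1.
have hinj : injective h.
  move=> x y eh; apply/eqP; rewrite -subr_eq0; apply: contraNT ntv => nz.
  have hz : h (x - y)%R = 1 by rewrite hD hN eh mulgV.
  have : (w *m mxval (x - y) = 0)%R by apply: (@rVabelem_inj _ _ _ abelV ntV); rewrite rVabelem0.
  move/(congr1 (mulmx^~ (mxval (x - y)^-1)%R)).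
  rewrite mul0mx -mulmxA -mxvalM (divff nz) mxval1 mulmx1 => w0.
  by rewrite -(abelem_rV_K abelV ntV vV) -/w w0 rVabelem0.
have gh : group_set (h @: setT).
  apply/group_setP; split=> [|_ _ /imsetP[x _ ->] /imsetP[y _ ->]].
    by rewrite -h0 imset_f.
  by rewrite -hD imset_f.
(* The scalar of [a] is found by search; on [A] the default 0 never occurs, as [a0 ^+ k] acts by
   [gr ^+ k]. *)
exists F, h, (fun a => odflt 0%R [pick y : F | (y != 0%R) && [forall x, h x ^ a == h (y * x)%R]]).
split; [exact: hinj | | exact: hD | move=> a aA].
  apply/eqP; rewrite eqEsubset; apply/andP; split.
    by apply/subsetP=> _ /imsetP[x _ ->].
  rewrite -{1}(irrA v) ?inE ?ntv // (gen_subG _ (Group gh)).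
  apply/subsetP=> _ /imsetP[a aA ->]; have [k ->] := cycle_a0 a aA.
  by rewrite -h1 hX imset_f.
case: pickP => [y /andP[nzy /forallP hy] | no]; first by split; [exact: nzy | move=> x; apply/eqP/hy].
have [k ak] := cycle_a0 a aA.
have /negP[] := no (gr ^+ k)%R; rewrite expf_neq0 //=.
by apply/forallP=> x; rewrite ak hX mulrC.
Qed.

(** * Arithmetic and finite fields *)

Section Arithmetic.
Local Open Scope nat_scope.

(** The totient is multiplicative over coprime factors, and [(p - 1) ^ 2 >= p] for an odd prime [p];
    induction removes one primary part at a time. *)
Lemma odd_leq_totient_sqr n : odd n -> n <= totient n ^ 2.
Proof.
elim/ltn_ind: n => n IHn odd_n; have n_gt0 : 0 < n by case: n odd_n {IHn}.
have [n1 | n_gt1] := leqP n 1; first by rewrite (leq_trans n1) // sqrn_gt0 totient_gt0.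
have p_pr := pdiv_prime n_gt1; have pn := pdiv_dvd n; set p := pdiv n in p_pr pn.
have oddp : odd p := dvdn_odd pn odd_n.
have defn := partnC p n_gt0.
have log_gt0 : 0 < logn p n by rewrite logn_gt0 mem_primes p_pr n_gt0.
have odd_m : odd n`_p^' by apply: dvdn_odd odd_n; apply: dvdn_part.
have ltm : n`_p^' < n.
  rewrite -{2}defn -[X in X < _]mul1n ltn_pmul2r ?part_gt0 // p_part.
  by rewrite -[1%N](exp1n (logn p n)) ltn_exp2r ?prime_gt1.
rewrite -{1 2}defn totient_coprime ?coprime_partC // expnMn.
apply: leq_mul; last exact: IHn.
rewrite p_part totient_pfactor // -{1}(prednK log_gt0) expnS expnMn leq_mul //.
  by case: p oddp p_pr {pn defn log_gt0 odd_m ltm} => [|[|[|p]]] //= _ _;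
     rewrite -mulnn mulnS -(addn1 p.+2) leq_add2l.
by rewrite -mulnn leq_pmulr // expn_gt0 prime_gt0.
Qed.

(** The factor 2 pays for the 2-part: [2 ^ k.+1] has totient [2 ^ k]. Equality holds at 2. *)
Lemma leq_totient_sqr n : n <= 2 * totient n ^ 2.
Proof.
case: (posnP n) => [-> // | n_gt0].
have odd_m : odd n`_2^' by rewrite odd_2'nat part_pnat.
rewrite -{1 2}(partnC 2 n_gt0) totient_coprime ?coprime_partC // expnMn mulnA.
apply: leq_mul; last exact: odd_leq_totient_sqr.
rewrite p_part; case: (logn 2 n) => // k.
rewrite totient_pfactor //= mul1n expnS leq_mul // -expnM leq_exp2l //.
by rewrite muln2 -addnn leq_addr.
Qed.

Lemma totient_le2 n : 0 < n -> totient n <= 2 -> n \in [:: 1; 2; 3; 4; 6]%N.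
Proof.
move=> n_gt0 le2; have le8 : n <= 8.
  by apply: leq_trans (leq_totient_sqr n) _; rewrite (leq_mul2l 2 _ 4) (leq_sqr _ 2).
have : all (fun k => (totient k <= 2) ==> (k \in [:: 1; 2; 3; 4; 6]%N)) (iota 1%N 8).
  by vm_compute.
by move/allP/(_ n); rewrite mem_iota n_gt0 ltnS le8 le2 => /(_ isT).
Qed.

(** The entries are [p], [n], the order of [A] and the index of [A] in [G0], where [V] has order
    [p ^ n]. *)
Definition candidates : seq (nat * nat * nat * nat) :=
  [:: (2,1,1,1); (2,2,3,1); (2,2,3,2); (2,3,7,3); (2,4,15,4); (2,6,21,6);
      (3,1,1,1); (3,1,2,1); (3,2,4,2); (3,2,8,2); (3,4,20,4);
      (5,1,4,1); (5,2,12,2); (7,1,3,1); (7,1,6,1)]%N.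

(* The totient bound leaves a <= 288, and k = (p ^ n - 1) / a <= 12. *)
Lemma candidatesP (p n a e : nat) :
  prime p -> 0 < n -> e \in [:: 1; 2; 3; 4; 6]%N -> e %| n -> 0 < a ->
  a %| (p ^ n).-1 -> totient a <= 2 * e -> (p ^ n).-1 %| 2 * (a * e) ->
  ((p == 2) || ~~ odd a -> (p ^ n).-1 %| a * e) ->
  (p, n, a, e) \in candidates.
Proof.
move=> p_pr n_gt0 eE en a_gt0 /dvdnP[k defq] lea qae qae1.
have e_gt0 : 0 < e by apply: dvdn_gt0 en.
have q_gt0 : 0 < p ^ n by rewrite expn_gt0 prime_gt0.
have q1_gt0 : 0 < (p ^ n).-1.
  by rewrite -ltnS prednK // -(exp1n n) ltn_exp2r // prime_gt1.
have defq1 : (a * k).+1 = p ^ n by rewrite mulnC -defq prednK.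
have e6 : e <= 6 by move: eE; rewrite !inE; do !case/predU1P=> [-> //|]; move/eqP->.
have k_dvd : k %| 2 * e.
  by rewrite defq mulnC mulnCA dvdn_pmul2l in qae.
have k_dvd1 : (p == 2) || ~~ odd a -> k %| e.
  by move/qae1; rewrite defq mulnC dvdn_pmul2l.
have k_gt0 : 0 < k by case: k defq {defq1 k_dvd k_dvd1} q1_gt0 => // ->.
have lek : k <= 12.
  by apply: leq_trans (dvdn_leq _ k_dvd) _; rewrite ?muln_gt0 // (leq_mul2l 2 _ 6).
have le_a : a <= 288.
  apply: leq_trans (leq_totient_sqr a) _; rewrite (leq_mul2l 2 _ 144) (leq_sqr _ 12).
  by apply: leq_trans lea _; rewrite (leq_mul2l 2 _ 6).
(* The field order is [a * k + 1], from which [p] and [n] are recovered; the search therefore runs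
   over [a], [e] and [k] only. *)
pose chk a e k := let q := (a * k).+1 in let p := pdiv q in let n := logn p q in
  [&& q == p ^ n, k %| 2 * e, e %| n & ((p == 2) || ~~ odd a) ==> (k %| e)] ==>
  ((p, n, a, e) \in candidates).
have : all (fun a => all (fun e => (totient a <= 2 * e) ==> all (chk a e) (iota 1%N 12))
              [:: 1; 2; 3; 4; 6]%N) (iota 1%N 288).
  by vm_compute.
move/allP/(_ a); rewrite mem_iota a_gt0 ltnS le_a => /(_ isT)/allP/(_ e eE).
rewrite lea => /allP/(_ k); rewrite mem_iota k_gt0 ltnS lek => /(_ isT).
rewrite /chk defq1 -(prednK n_gt0) pdiv_pfactor // prednK // pfactorK // eqxx k_dvd en /=.
by move/implyP; apply; apply/implyP.
Qed.

End Arithmetic.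

(** * Finite fields: primitive roots, automorphisms and the prime subfield *)

Section FiniteField.
Variable F : finFieldType.
Local Open Scope ring_scope.

Let pred_card_gt0 : (0 < #|F|.-1)%N.
Proof. by rewrite -ltnS (ltn_predK (finNzRing_gt1 F)) finNzRing_gt1. Qed.

Lemma expf_card_pred (x : F) : x != 0 -> x ^+ #|F|.-1 = 1.
Proof.
move=> nzx; apply: (mulfI nzx).
by rewrite -exprS mulr1 (ltn_predK (finNzRing_gt1 F)) expf_card.
Qed.

Lemma finField_prim_root : exists w : F, (#|F|.-1).-primitive_root w.
Proof.
pose rs := [seq x <- enum F | x != 0].
have/hasP[w _ pw] : has (#|F|.-1).-primitive_root rs; last by exists w.
apply: has_prim_root => //.
- by apply/allP=> x; rewrite mem_filter unity_rootE => /andP[/expf_card_pred-> _].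
- by rewrite filter_uniq ?enum_uniq.
rewrite -(card_uniqP (filter_uniq _ (enum_uniq F))) -(cardC1 (0 : F)).
by rewrite subset_leq_card //; apply/subsetP=> x; rewrite inE mem_filter mem_enum andbT.
Qed.

Lemma poly_fun_eq (P Q : {poly F}) :
  (size P <= #|F|)%N -> (size Q <= #|F|)%N -> (forall x, P.[x] = Q.[x]) -> P = Q.
Proof.
move=> sP sQ ePQ; apply/eqP; rewrite -subr_eq0; apply: contraT => nz.
have rootPQ : all (root (P - Q)) (enum F).
  by apply/allP=> x _; rewrite rootE hornerD hornerN ePQ subrr.
have := max_poly_roots nz rootPQ (enum_uniq F); rewrite -cardE ltnNge.
by rewrite (leq_trans (size_polyD _ _)) // size_polyN geq_max sP.
Qed.

Variable p : nat.
Hypothesis charFp : p \in [pchar F].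
Let p_pr := pcharf_prime charFp.

Lemma expf_pchar_inj i : injective (fun x : F => x ^+ (p ^ i)).
Proof.
elim: i => [|i IHi] x y; first by rewrite !expn0 !expr1.
by rewrite expnSr !exprM => /(fmorph_inj (pFrobenius_aut charFp))/IHi.
Qed.

(* An automorphism is x |-> x ^ m on a primitive root, hence everywhere; after
   removing the p-part of m, differentiating (1 + X)^m = 1 + X^m forces m = 1. *)
Lemma field_aut_exp s : s \in field_auts F -> exists i, forall x, s x = x ^+ (p ^ i).
Proof.
rewrite inE => /forallP aut_s.
have sD x y : s (x + y) = s x + s y by have /forallP/(_ y)/andP[/eqP] := aut_s x.
have sM x y : s (x * y) = s x * s y by have /forallP/(_ y)/andP[_ /eqP] := aut_s x.
have s0 : s 0 = 0 by apply: (addrI (s 0)); rewrite -sD !addr0.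
have s1 : s 1 = 1.
  have nzs1 : s 1 != 0 by rewrite -s0 (inj_eq perm_inj) oner_eq0.
  by apply: (mulfI nzs1); rewrite -sM !mulr1.
have sX x k : s (x ^+ k) = s x ^+ k.
  by elim: k => [|k IHk]; rewrite ?expr0 // !exprS sM IHk.
have [w prim_w] := finField_prim_root.
have nzw : w != 0.
  apply/eqP=> w0; have := prim_expr_order prim_w.
  by rewrite w0 expr0n eqn0Ngt pred_card_gt0 => /eqP; rewrite eq_sym oner_eq0.
(* An exponent 0 is traded for [#|F|.-1], so that [x ^+ m] also gives the right value at [x = 0]. *)
have [m /andP[m_gt0 ltm] sw] : exists2 m, (0 < m < #|F|)%N & s w = w ^+ m.
  have : s w ^+ #|F|.-1 = 1 by rewrite -sX (prim_expr_order prim_w).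
  case/(prim_rootP prim_w)=> -[[|m] ltm] /= ->.
    exists #|F|.-1; last by rewrite (prim_expr_order prim_w).
    by rewrite pred_card_gt0 ltn_predL ltnW ?finNzRing_gt1.
  by exists m.+1 => //=; apply: leq_trans ltm (leq_pred _).
have sE x : s x = x ^+ m.
  have [-> | nzx] := eqVneq x 0; first by rewrite s0 expr0n -leqn0 leqNgt m_gt0.
  have [[k ltk] /= ->] := prim_rootP prim_w (expf_card_pred nzx).
  by rewrite sX sw -!exprM mulnC.
pose i := logn p m; pose m' := (m`_p^')%N.
have defm : m = (p ^ i * m')%N by rewrite -{1}(partnC p m_gt0) p_part.
have m'_gt0 : (0 < m')%N by apply: part_gt0.
have nzm' : m'%:R != 0 :> F.
  by rewrite -(dvdn_pcharf charFp) -p'natE // part_pnat.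
have bij_i : bijective (fun x : F => x ^+ (p ^ i)).
  by apply: injF_bij; apply: expf_pchar_inj.
have ltm' : (m' < #|F|)%N.
  by apply: leq_ltn_trans ltm; rewrite defm leq_pmull // expn_gt0 prime_gt0.
have : ('X - (-1)%:P) ^+ m' = 'X^m' + 1%:P :> {poly F}.
  apply: poly_fun_eq; rewrite ?size_exp_XsubC ?size_XnaddC // => y.
  have [g _ gK] := bij_i; rewrite -[y]gK; move: (g y) => z.
  rewrite !hornerE -exprM -defm opprK -sE -[in RHS]s1 -sD sE defm exprM.
  rewrite [(z + 1) ^+ (p ^ i)]exprDn_pchar ?expr1n //.
  by rewrite pnatX pnatE // charFp.
move/(congr1 (fun P => (P^`()).[0])).
(* At 0 the two derivatives are [m'] and [m'] times [0 ^+ m'.-1]. Since [m'] is nonzero in [F], this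
   leaves only [m' = 1]. *)
rewrite deriv_exp derivXsubC mul1r derivD derivXn derivC addr0 !hornerMn.
rewrite !hornerE ?opprK expr1n => /eqP.
case: m' nzm' defm {m'_gt0 ltm'} => [|[|m']] nzm' defm /=; first by rewrite eqxx in nzm'.
  by move=> _; exists i => x; rewrite sE defm muln1.
by rewrite expr0n mul0rn (negPf nzm').
Qed.

Lemma field_auts_cycle n : #|F| = (p ^ n)%N ->
  exists phi : {perm F},
    [/\ forall k x, (phi ^+ k)%g x = x ^+ (p ^ k), field_auts F = <[phi]>%g & #[phi]%g = n].
Proof.
move=> cardF; pose phi := perm (fmorph_inj (pFrobenius_aut charFp)).
have n_gt0 : (0 < n)%N by case: n cardF (finNzRing_gt1 F) => // ->.
have phiX k x : (phi ^+ k)%g x = x ^+ (p ^ k).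
  elim: k x => [|k IHk] x; first by rewrite expg0 perm1 expn0 expr1.
  by rewrite expgSr permM IHk permE /= pFrobenius_autE expnSr exprM.
exists phi; split=> //.
  apply/setP=> s; apply/idP/cycleP=> [/field_aut_exp[i si] | [i ->]].
    by exists i; apply/permP=> x; rewrite si phiX.
  rewrite inE; apply/'forall_forallP=> x y; rewrite !phiX exprMn eqxx andbT.
  by rewrite exprDn_pchar // pnatX pnatE // charFp.
apply/eqP; rewrite eqn_leq dvdn_leq //=; last first.
  by rewrite order_dvdn; apply/eqP/permP=> x; rewrite phiX perm1 -cardF expf_card.
(* If the order [k] of Frobenius were below [n], then [X ^ (p ^ k)] and [X] would agree as functions
   in degree below [#|F|], hence as polynomials. *)
rewrite leqNgt; apply/negP=> lt_n; have k_gt0 := order_gt0 phi.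
have lt_q : (p ^ #[phi]%g < #|F|)%N by rewrite cardF ltn_exp2l ?prime_gt1.
have : 'X^(p ^ #[phi]%g) = 'X :> {poly F}.
  apply: poly_fun_eq; rewrite ?size_polyXn ?size_polyX ?finNzRing_gt1 // => x.
  by rewrite !hornerE -phiX expg_order perm1.
move/(congr1 (size : {poly F} -> nat)); rewrite size_polyXn size_polyX => -[e].
by have := ltn_expl #[phi]%g (prime_gt1 p_pr); rewrite e ltnS leqNgt k_gt0.
Qed.

Definition Fp_emb (i : 'F_p) : F := (i : nat)%:R.

Lemma Fp_embD i j : Fp_emb (i + j) = Fp_emb i + Fp_emb j.
Proof.
rewrite /Fp_emb /= -natrD -[RHS](GRing.natr_mod_pchar charFp).
by rewrite [X in (_ %% X)%N](Fp_cast p_pr).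
Qed.

Lemma Fp_embM i j : Fp_emb (i * j) = Fp_emb i * Fp_emb j.
Proof.
rewrite /Fp_emb /= -natrM -[RHS](GRing.natr_mod_pchar charFp).
by rewrite [X in (_ %% X)%N](Fp_cast p_pr).
Qed.

Lemma Fp_emb1 : Fp_emb 1 = 1.
Proof. by rewrite /Fp_emb /= modn_small // Fp_cast // prime_gt1. Qed.

Lemma Fp_embN i : Fp_emb (- i) = - Fp_emb i.
Proof. by apply/eqP; rewrite -addr_eq0 -Fp_embD addNr. Qed.

Lemma Fp_emb_eq0 i : (Fp_emb i == 0) = (i == 0).
Proof.
have [-> | nzi] := eqVneq i 0; first exact: eqxx.
apply/negP=> /eqP i0; have := Fp_embM i i^-1.
by rewrite divff // Fp_emb1 i0 mul0r => /eqP; rewrite oner_eq0.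
Qed.

Lemma Fp_emb_inj : injective Fp_emb.
Proof.
move=> i j eij; apply/eqP; rewrite -subr_eq0 -Fp_emb_eq0 Fp_embD Fp_embN eij.
by rewrite subrr.
Qed.

Lemma Fp_embX i k : Fp_emb (i ^+ k) = Fp_emb i ^+ k.
Proof. by elim: k => [|k IHk]; rewrite ?Fp_emb1 // !exprS Fp_embM IHk. Qed.

End FiniteField.

(** * Affine groups *)

(** Some commutator [[~ x, u]] with [u] in [V] is nontrivial. It lies in [V] and in the normal
    closure of [x], and by minimality its own normal closure is [V]. *)
Lemma minnormal_sub_nclosure (gT : finGroupType) (G V : {group gT}) x :
  V \subset G -> minnormal V G -> x \in G -> x \notin 'C(V) -> V \subset <<x ^: G>>.
Proof.
move=> sVG minV xG ncx; have [/andP[_ nVG] _] := mingroupP minV.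
have [u uV nux] : exists2 u, u \in V & [~ x, u] != 1.
  apply/exists_inP; apply: contraR ncx => /exists_inPn H.
  by apply/centP=> u uV; apply/commgP; apply: negbNE (H u uV).
have uG := subsetP sVG u uV.
rewrite -(minnormal_nclosure minV (x := [~ x, u])).
  by rewrite nclosure_sub ?nclosure_norm ?mem_nclosureR.
rewrite !inE nux commgEr groupM // memJ_norm ?groupV //.
by rewrite (subsetP nVG).
Qed.

(** The normal closures of [x] and [x * w] both contain [V], hence coincide, so the Magnus property
    would make the orders equal. *)
Lemma not_MP_order (gT : finGroupType) (G V : {group gT}) x w :
  V \subset G -> minnormal V G -> abelian V -> x \in G -> x \notin 'C(V) -> w \in V ->
  #[x * w] != #[x] -> ~ MP G.
Proof.
move=> sVG minV abV xG ncx wV /eqP nord mpG; apply: nord.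
have wG := subsetP sVG w wV.
apply: (MP_order mpG); rewrite ?groupM //; apply: nclosure_eq.
  by rewrite groupM ?mem_nclosure // (subsetP (minnormal_sub_nclosure sVG minV xG ncx)).
have ncxw : x * w \notin 'C(V) by rewrite groupMr // (subsetP abV).
rewrite -{1}[x](mulgK w) groupM ?mem_nclosure // groupV.
by rewrite (subsetP (minnormal_sub_nclosure _ minV _ ncxw)) ?groupM.
Qed.

(** * Semidirect products [V ><| G0] and their affine action on [V] *)

Section Semidirect.
Variables (gT : finGroupType) (G V G0 : {group gT}).
Hypothesis defG : V ><| G0 = G.

(** A nontrivial [y] in [G0] centralises nothing in [V] but 1, so its class under [V] has [#|V|]
    elements and fills the coset [V :* y]. *)
Lemma semiregular_conj x : semiregular V G0 -> x \in G -> x \notin V ->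
  exists2 y, y \in G0 & x \in y ^: V.
Proof.
move=> regG; have [_ <- nVG tiVG] := sdprodP defG.
case/mulsgP=> u y uV yG ->; have [-> | nty _] := eqVneq y 1; first by rewrite mulg1 uV.
have nVy : y \in 'N(V) := subsetP nVG y yG.
exists y => //; suff -> : y ^: V = V :* y by rewrite mem_rcoset mulgK.
apply/eqP; rewrite eqEcard card_rcoset -index_cent1 regG ?indexg1 ?leqnn ?andbT; last first.
  by rewrite !inE nty.
apply/subsetP=> _ /imsetP[w wV ->]; rewrite mem_rcoset conjgE -!mulgA.
by rewrite groupM ?groupV // -[y in y * _]invgK -conjgE memJ_norm ?groupV.
Qed.

(** The product of [V] and [<<y ^: G0>>] is normalised by [G], and it meets the complement [G0] in
    [<<y ^: G0>>] only. *)
Lemma nclosure_complement x y : x \in G0 -> y \in G0 ->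
  x \in <<y ^: G>> -> x \in <<y ^: G0>>.
Proof.
have [_ eG nVG tiVG] := sdprodP defG => xG yG.
have nV : G0 \subset 'N(V <*> <<y ^: G0>>).
  by rewrite normsY // nclosure_norm.
have sK : <<y ^: G0>> \subset G0 by rewrite nclosure_sub ?normG.
have /subsetP sub : <<y ^: G>> \subset V <*> <<y ^: G0>>.
  apply: nclosure_sub; first by rewrite (subsetP (joing_subr _ _)) ?mem_nclosure.
  by rewrite -eG mul_subG // (subset_trans _ (normG _)) // joing_subl.
move/sub; rewrite norm_joinEr ?(subset_trans sK) // => /mulsgP[v k vV kK ex].
have : v \in V :&: G0.
  by rewrite inE vV -[v](mulgK k) -ex groupM ?groupV ?(subsetP sK _ kK).
by rewrite tiVG ex => /set1gP->; rewrite mul1g.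
Qed.

(** Elements of [V] are covered by the hypothesis on [V^#]; all others are conjugate into [G0],
    where normal closures in [G] and in [G0] determine each other. *)
Lemma MP_semiregular : abelian V -> semiregular V G0 -> MP G0 ->
  {in V^# &, forall x y, x \in y ^: G \/ x \in y^-1 ^: G} -> MP G.
Proof.
move=> abV regG mpG0 pmV x y xG yG exy.
have [nsVG sG0G eG nVG tiVG] := sdprod_context defG; have [sVG nVGG] := andP nsVG.
have inV z t : <<z ^: G>> = <<t ^: G>> -> z \in V -> t \in V.
  move=> ezt zV; have : <<z ^: G>> \subset V by rewrite nclosure_sub.
  by rewrite ezt => /subsetP->; rewrite ?mem_nclosure.
have eq1 z t : <<z ^: G>> = <<t ^: G>> -> z = 1 -> t = 1.
  move=> ezt z1; have := mem_nclosure G t; rewrite -ezt z1 class1G genGid.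
  by move/set1gP.
have [xV | nxV] := boolP (x \in V).
  have yV := inV x y exy xV.
  have [x1 | ntx] := eqVneq x 1; first by rewrite x1 (eq1 x y) //; left; apply: class_refl.
  apply: pmV; rewrite !inE ?ntx ?xV ?yV ?andbT //.
  by apply: contra_neq ntx => y1; apply: (eq1 y).
have nyV : y \notin V by apply: contra nxV; apply: inV.
have [x0 x0G xx0] := semiregular_conj regG xG nxV.
have [y0 y0G yy0] := semiregular_conj regG yG nyV.
have /class_eqP ex : x \in x0 ^: G by apply: subsetP xx0; apply: imsetS.
have /class_eqP ey : y \in y0 ^: G by apply: subsetP yy0; apply: imsetS.
have e0 : <<x0 ^: G>> = <<y0 ^: G>> by rewrite -ex -ey.
have /(mpG0 _ _ x0G y0G) : <<x0 ^: G0>> = <<y0 ^: G0>>.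
  apply: nclosure_eq; apply: nclosure_complement => //.
    by rewrite -e0 mem_nclosure.
  by rewrite e0 mem_nclosure.
have sub z : z ^: G0 \subset z ^: G by apply: imsetS.
have xx : x \in x0 ^: G by rewrite -ex class_refl.
case=> /(subsetP (sub _))/class_eqP H; [left | right].
  by rewrite ey -H.
by rewrite classVg ey -classVg -H.
Qed.

(* The action of G = G0 * V on the right cosets of G0. *)
Lemma affine_morphism (X : finType) (k : X -> gT) (P : {set {perm X}}) :
  'C_G0(V) = 1 -> injective k -> k @: setT = V ->
  (forall q : {perm X}, q \in P <->
     exists2 g, g \in G0 & exists2 v, v \in V & forall x, k (q x) = k x ^ g * v) ->
  exists2 f : {morphism G >-> {perm X}}, 'injm f & f @* G = P.
Proof.
move=> ffulG k_inj im_k memP.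
have [_ sG0G eG nVG tiVG] := sdprod_context defG.
have eG' : G0 * V = G by rewrite -eG normC.
have tiGV : G0 :&: V = 1 by rewrite setIC.
have kV x : k x \in V by rewrite -im_k imset_f.
have kP v : v \in V -> exists x, k x = v by rewrite -im_k => /imsetP[x _ ->]; exists x.
pose act y u := u ^ (divgr G0 V y) * remgr G0 V y.
have actE g v u : g \in G0 -> v \in V -> act (g * v) u = u ^ g * v.
  by move=> gG vV; rewrite /act divgrMid ?remgrMid.
have exq y : y \in G -> exists q : {perm X}, forall x, k (q x) = act y (k x).
  rewrite -eG' => /mulsgP[g v gG vV ->].
  have exf x : exists z, k z == k x ^ g * v.
    have [|z <-] := kP (k x ^ g * v); last by exists z.
    by rewrite groupM // memJ_norm // (subsetP nVG).
  have f_inj : injective (fun x => xchoose (exf x)).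
    move=> x z exz; apply: k_inj; apply: (conjg_inj g); apply: (mulIg v).
    by rewrite -(eqP (xchooseP (exf x))) exz (eqP (xchooseP (exf z))).
  by exists (perm f_inj) => x; rewrite permE (eqP (xchooseP (exf x))) actE.
pose f y : {perm X} := odflt 1 [pick q : {perm X} | [forall x, k (q x) == act y (k x)]].
have fE y x : y \in G -> k (f y x) = act y (k x).
  move=> yG; rewrite /f; case: pickP => [q /eqfunP // | no].
  by have [q qE] := exq y yG; have /eqfunP[] := negbT (no q).
have fM : {in G &, {morph f : y z / y * z}}.
  move=> y z yG zG; apply/permP=> x; apply: k_inj; rewrite permM !fE ?groupM //.
  move: yG zG; rewrite -eG' => /mulsgP[g v gG vV ->] /mulsgP[g' v' g'G v'V ->].
  have -> : g * v * (g' * v') = (g * g') * (v ^ g' * v').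
    by rewrite conjgE !mulgA mulgK.
  have vgV : v ^ g' * v' \in V by apply: groupM; rewrite // memJ_norm // (subsetP nVG).
  by rewrite !actE ?(groupM gG g'G) // conjMg conjgM mulgA.
exists (Morphism fM).
  apply/injmP=> y z yG zG /= efyz; have fxy x : act y (k x) = act z (k x).
    by rewrite -!fE // efyz.
  move: yG zG fxy; rewrite -eG' => /mulsgP[g v gG vV ->] /mulsgP[g' v' g'G v'V ->] fxy.
  have fu u : u \in V -> u ^ g * v = u ^ g' * v'.
    by case/kP=> x <-; have := fxy x; rewrite !actE.
  have evv : v = v' by have := fu 1 (group1 V); rewrite !conj1g !mul1g.
  rewrite evv; congr (_ * _); apply/eqP; rewrite eq_mulgV1; apply/eqP/set1gP.
  rewrite -ffulG inE groupM ?groupV //=; apply/centP=> u uV.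
  apply: commute_sym; apply/commgP/conjg_fixP; have := fu u uV.
  by rewrite evv conjgM => /mulIg->; rewrite conjgK.
apply/setP=> q; apply/idP/idP=> [/morphimP[y _ yG ->] | /memP[g gG [v vV qE]]].
  have /mulsgP[g v gG vV ey] : y \in G0 * V by rewrite eG'.
  by apply/memP; exists g => //; exists v => // x; rewrite /= fE // ey actE.
have gvG : g * v \in G by rewrite -eG' mem_mulg.
apply/morphimP; exists (g * v) => //; apply/permP=> x; apply: k_inj.
by rewrite qE /= fE // actE.
Qed.

Variables (X : finType) (k : X -> gT).
Hypotheses (ffulG : 'C_G0(V) = 1) (k_inj : injective k) (im_k : k @: setT = V).

Lemma affine_isog (P : {set {perm X}}) :
  (forall q : {perm X}, q \in P <->
     exists2 g, g \in G0 & exists2 v, v \in V & forall x, k (q x) = k x ^ g * v) ->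
  G \isog <<P>>.
Proof.
case/(affine_morphism ffulG k_inj im_k) => f injf <-.
by rewrite genGid; apply: sub_isog.
Qed.

Lemma perm_morphism : exists f : {morphism G >-> {perm X}}, 'injm f.
Proof.
pose P := [set q : {perm X} | [exists g in G0, exists v in V, forall x, k (q x) == k x ^ g * v]].
have [q|f injf _] := @affine_morphism X k P ffulG k_inj im_k; last by exists f.
rewrite inE; split=> [/exists_inP[g gG /exists_inP[v vV /eqfunP qE]] | [g gG [v vV qE]]].
  by exists g => //; exists v.
by apply/exists_inP; exists g => //; apply/exists_inP; exists v => //; apply/eqfunP.
Qed.

Lemma isog_Sym : #|G| = (#|X|)`! -> G \isog [set: {perm X}].
Proof.
move=> cardG; have [f injf] := perm_morphism.
suff <- : f @* G = setT by apply: sub_isog.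
by apply/eqP; rewrite eqEcard subsetT /= card_injm // cardG -card_Sym.
Qed.

Lemma odd_permX (s : {perm X}) m : odd_perm (s ^+ m) = odd m && odd_perm s.
Proof.
elim: m => [|m IHm]; first by rewrite expg0 odd_perm1.
by rewrite expgS odd_permM IHm /=; case: odd_perm; case: odd.
Qed.

(** Commutators and elements of odd order act as even permutations, so the embedded [G] lies in the
    alternating group; the orders agree. *)
Lemma isog_Alt : 1 < #|X| -> (2 * #|G|)%N = (#|X|)`! -> odd #|G0| -> V \subset G^`(1) ->
  G \isog 'Alt_X.
Proof.
move=> X_gt1 cardG oddG sVG'; have [f injf] := perm_morphism.
have [_ eG _ _] := sdprodP defG.
suff sub : f @* G \subset 'Alt_X.
  suff <- : f @* G = 'Alt_X by apply: sub_isog.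
  apply/eqP; rewrite eqEcard sub card_injm //= -(leq_pmul2l (isT : 0 < 2)) cardG.
  by rewrite card_Alt.
have /subsetP derA : (f @* G)^`(1) \subset 'Alt_X.
  rewrite gen_subG; apply/subsetP=> _ /imset2P[s t _ _ ->].
  by rewrite Alt_even commgEl odd_permM odd_permV odd_permJ addbb.
apply/subsetP=> _ /morphimP[y _ yG ->]; move: yG.
rewrite -{1}eG => /mulsgP[v g vV gG ->]; have gGG : g \in G by rewrite -eG -[g]mul1g mem_mulg.
have vG' := subsetP sVG' v vV; have vG : v \in G := subsetP (der_sub 1 G) v vG'.
rewrite morphM // groupM //; first by rewrite derA // -morphim_der // mem_morphim.
rewrite Alt_even; have /esym := odd_permX (f g) #[g].
rewrite -morphX // expg_order morph1 odd_perm1.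
by rewrite (dvdn_odd (order_dvdG gG) oddG) => /= ->.
Qed.

End Semidirect.

(** * The semilinear model *)

Lemma index2_divl (gT : finGroupType) (G H : {group gT}) g k :
  H \subset G -> #|G : H| = 2 -> g \in G -> k \in G -> g \notin H -> k \notin H ->
  g^-1 * k \in H.
Proof.
move=> sHG iGH gG kG nHg nHk; have eG : G :=: H :|: g *: H.
  apply/esym/eqP; rewrite eqEcard subUset sHG mul_subG ?sub1set //=.
  rewrite cardsU card_lcoset (_ : H :&: g *: H = set0) ?cards0 ?subn0.
    by rewrite -(Lagrange sHG) iGH muln2 addnn.
  apply/setP=> x; rewrite !inE mem_lcoset; apply: contraNF nHg => /andP[xH].
  by rewrite groupMr // groupV.
by move: kG; rewrite eG inE (negPf nHk) mem_lcoset.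
Qed.

(** * The matrices generating [Q8set], as semilinear maps on the plane spanned by 1 and a square
    root of -1 *)

Section QuaternionMatrices.
Variables (F : finFieldType) (i : F).
Hypotheses (ch3 : 3 \in [pchar F]%R) (i2 : (i ^+ 2 = -1)%R).
Local Open Scope ring_scope.
Local Notation r := (@Fp_emb F 3).

Definition col_emb (w : 'cV['F_3]_2) : F := r (w ord0 ord0) + r (w ord_max ord0) * i.

Lemma col_embD v w : col_emb (v + w) = col_emb v + col_emb w.
Proof. by rewrite /col_emb !mxE !(Fp_embD ch3) mulrDl addrACA. Qed.

Lemma F3_sum_squares (x y : 'F_3) : x ^+ 2 + y ^+ 2 = 0 -> x = 0 /\ y = 0.
Proof.
case: x y => [[|[|[|x]]] // lx] [[|[|[|y]]] // ly] /(congr1 val) //= _.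
by split; apply: val_inj.
Qed.

(** A kernel vector [(x, y)] satisfies [x = - y * i], hence [x ^+ 2 + y ^+ 2 = 0], and this form is
    anisotropic over ['F_3]. *)
Lemma col_emb_inj : injective col_emb.
Proof.
move=> v w e; pose u := v - w; suff u0 : u = 0 by apply/eqP; rewrite -subr_eq0 -/u u0.
have ku : col_emb u = 0.
  by apply: (addIr (col_emb w)); rewrite -col_embD subrK e add0r.
have : r (u ord0 ord0 ^+ 2 + u ord_max ord0 ^+ 2) = 0.
  rewrite (Fp_embD ch3) !(Fp_embX ch3).
  have -> : r (u ord0 ord0) = - (r (u ord_max ord0) * i).
    by apply/eqP; rewrite -addr_eq0 -/(col_emb u) ku.
  by rewrite sqrrN exprMn i2 mulrN1 addNr.
move/eqP; rewrite (Fp_emb_eq0 ch3) => /eqP/F3_sum_squares[u00 u10].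
apply/matrixP=> a b; rewrite [b]ord1 [RHS]mxE; case: a => [[|[|a]] // la].
  by rewrite -[RHS]u00; congr (u _ _); apply: val_inj.
by rewrite -[RHS]u10; congr (u _ _); apply: val_inj.
Qed.

Lemma mx22_col a b c d (w : 'cV['F_3]_2) :
  col_emb (mx22 a b c d *m w) =
  r (a * w ord0 ord0 + b * w ord_max ord0) + r (c * w ord0 ord0 + d * w ord_max ord0) * i.
Proof.
have eM : lift ord0 ord0 = ord_max :> 'I_2 by apply: val_inj.
by rewrite /col_emb !mxE !big_ord_recl !big_ord0 !addr0 !mxE /= eM.
Qed.

Lemma Fp_emb2 : r 2%:R = - 1.
Proof.
apply/eqP; rewrite -addr_eq0 -(Fp_emb1 F 3) -(Fp_embD ch3) (Fp_emb_eq0 ch3).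
by apply/eqP/val_inj.
Qed.

Lemma col_emb_i w : col_emb (Q8i *m w) = i * col_emb w.
Proof.
rewrite mx22_col mul0r add0r mul1r mul0r addr0 (Fp_embM ch3) Fp_emb2 mulN1r.
by rewrite /col_emb mulrDr mulrCA -expr2 i2 mulrN1 addrC mulrC.
Qed.

(** Cubing fixes the prime field and sends [i] to [- i], and [(1 + i) * (x - y * i) = (x + y) + (x -
    y) * i], where [- y] is [2 * y]. *)
Lemma col_emb_j w : col_emb (Q8j *m w) = (1 + i) * col_emb w ^+ 3.
Proof.
have cube x : r x ^+ 3 = r x.
  by rewrite -(Fp_embX ch3); have := expf_card x; rewrite card_Fp // => ->.
rewrite mx22_col !mul1r !(Fp_embD ch3) (Fp_embM ch3) Fp_emb2 mulN1r.
rewrite /col_emb exprDn_pchar ?pnatE // exprMn !cube exprS i2 mulrN1.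
set x := r _; set y := r _.
rewrite mulrN [RHS]mulrDl mul1r mulrBr [i * (y * i)]mulrCA -expr2 i2 mulrN1 opprK.
by rewrite mulrBl [i * x]mulrC addrACA [RHS]addrACA [y - _]addrC.
Qed.

End QuaternionMatrices.

(** * [G0] as a group of semilinear maps of [F], and the resulting numerical constraints *)

Section SemilinearModel.
Variables (gT : finGroupType) (p n : nat) (V G0 A : {group gT}).
Variables (F : finFieldType) (h : F -> gT) (c : gT -> F).
Hypotheses (p_pr : prime p) (cardF : #|F| = (p ^ n)%N).
Hypotheses (nVG : G0 \subset 'N(V)) (ffulG : 'C_G0(V) = 1).
Hypothesis pmtr : {in V^# &, forall x y, x \in y ^: G0 \/ x \in y^-1 ^: G0}.
Hypotheses (nsAG : A <| G0) (cycA : cyclic A) (CA : 'C_G0(A) = A).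
Hypothesis irrA : {in V^#, forall v, <<v ^: A>> = V}.
Hypotheses (h_inj : injective h) (im_h : h @: setT = V).
Hypothesis hD : {morph h : x y / (x + y)%R >-> x * y}.
Hypothesis hA : {in A, forall a, c a != 0%R /\ forall x, h x ^ a = h (c a * x)%R}.
Hypothesis mpG : MP G0.

Let sAG := normal_sub nsAG.
Let charFp : p \in [pchar F]%R := card_finPcharP cardF p_pr.

Lemma model_in x : h x \in V. Proof. by rewrite -im_h imset_f. Qed.

Lemma model0 : h 0%R = 1.
Proof. by apply: (mulgI (h 0%R)); rewrite -hD addr0 mulg1. Qed.

Lemma modelN x : h (- x)%R = (h x)^-1.
Proof. by apply: (mulgI (h x)); rewrite -hD subrr model0 mulgV. Qed.

Lemma model_eq1 x : (h x == 1) = (x == 0%R).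
Proof. by rewrite -model0 (inj_eq h_inj). Qed.

Lemma modelX x k : h (x *+ k)%R = h x ^+ k.
Proof. by elim: k => [|k IHk]; rewrite ?model0 // mulrS hD IHk expgS. Qed.

Definition model_inv v : F := odflt 0%R [pick x | h x == v].

Lemma model_invK v : v \in V -> h (model_inv v) = v.
Proof.
rewrite -im_h => /imsetP[x _ ->]; rewrite /model_inv.
by case: pickP => [y /eqP // | /(_ x)]; rewrite eqxx.
Qed.

Definition lam g (x : F) : F := model_inv (h x ^ g).

Lemma lamE g x : g \in G0 -> h x ^ g = h (lam g x).
Proof. by move=> gG; rewrite model_invK // memJ_norm ?model_in // (subsetP nVG). Qed.

Lemma lamD g x y : g \in G0 -> (lam g (x + y) = lam g x + lam g y)%R.
Proof. by move=> gG; apply: h_inj; rewrite hD -!lamE // hD conjMg. Qed.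

Lemma lamM g k x : g \in G0 -> k \in G0 -> lam (g * k) x = lam k (lam g x).
Proof. by move=> gG kG; apply: h_inj; rewrite -!lamE ?groupM // conjgM. Qed.

Lemma lamA a x : a \in A -> lam a x = (c a * x)%R.
Proof.
move=> aA; apply: h_inj; rewrite -lamE ?(subsetP sAG) //.
by have [_ ->] := hA aA.
Qed.

Lemma lam_inj g : g \in G0 -> injective (lam g).
Proof. by move=> gG x y e; apply: h_inj; apply: (conjg_inj g); rewrite !lamE ?e. Qed.

Lemma lam0 g : g \in G0 -> lam g 0%R = 0%R.
Proof. by move=> gG; apply: h_inj; rewrite -lamE // model0 conj1g. Qed.

Lemma lam1_neq0 g : g \in G0 -> lam g 1%R != 0%R.
Proof. by move=> gG; rewrite -(lam0 gG) (inj_eq (lam_inj gG)) oner_eq0. Qed.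

Lemma lam_ffull g k : g \in G0 -> k \in G0 -> lam g =1 lam k -> g = k.
Proof.
move=> gG kG egk; apply/eqP; rewrite eq_mulgV1; apply/eqP/set1gP.
rewrite -ffulG inE groupM ?groupV //=; apply/centP=> v vV.
rewrite -(model_invK vV); apply: commute_sym; apply/commgP/conjg_fixP.
by rewrite conjgM lamE // egk -lamE // conjgK.
Qed.

(** An additive induction principle: the elements [h (c a)] form the [A]-orbit of [h 1], which
    generates [V]. *)
Lemma model_ind (S : {group gT}) : {in A, forall a, h (c a) \in S} -> V \subset S.
Proof.
move=> Sc; rewrite -(irrA (x := h 1%R)).
  rewrite gen_subG; apply/subsetP=> _ /imsetP[a aA ->].
  by have [_ ->] := hA aA; rewrite mulr1 Sc.
by rewrite !inE model_eq1 oner_eq0 model_in.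
Qed.

(* Up to the factor lam g 1, g acts on F as a ring automorphism because it
   normalises A, whose multiplications span F additively. *)
Lemma lam_field_aut g : g \in G0 ->
  exists2 s, s \in field_auts F & forall x, lam g x = (lam g 1 * s x)%R.
Proof.
move=> gG; have nz := lam1_neq0 gG; pose s x := (lam g x / lam g 1)%R.
have sE x : lam g x = (lam g 1 * s x)%R by rewrite mulrC divfK.
have s_inj : injective s by move=> x y /(divIf nz)/(lam_inj gG).
have s1 : s 1%R = 1%R by rewrite /s divff.
have sD x y : s (x + y)%R = (s x + s y)%R by rewrite /s lamD // mulrDl.
have sc a x : a \in A -> s (c a * x)%R = (c (a ^ g) * s x)%R.
  move=> aA; have agA : a ^ g \in A by rewrite memJ_norm // (subsetP (normal_norm nsAG)).
  by rewrite /s mulrA -!lamA // -!lamM ?(subsetP sAG _ aA) ?(subsetP sAG _ agA) // -conjgC.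
have sM : forall x y, s (x * y)%R = (s x * s y)%R.
  move=> x y.
  (* For fixed [y], the [x] that satisfy the identity form an additive subgroup containing every
     [c a]. *)
  pose Sy := [set v in V | s (model_inv v * y)%R == (s (model_inv v) * s y)%R].
  have hinvK z : model_inv (h z) = z by apply: h_inj; rewrite model_invK ?model_in.
  have gS : group_set Sy.
    apply/group_setP; split.
      rewrite inE group1 -model0 hinvK mul0r.
      by have -> : s 0%R = 0%R; rewrite ?mul0r ?eqxx // /s lam0 // mul0r.
    move=> u v; rewrite !inE => /andP[uV /eqP su] /andP[vV /eqP sv].
    rewrite groupM //= -(model_invK uV) -(model_invK vV) -hD hinvK.
    by rewrite mulrDl !sD su sv mulrDl.
  have : V \subset Group gS.
    apply: model_ind => a aA; rewrite inE model_in /= hinvK sc //.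
    by rewrite -[c a]mulr1 sc // s1 mulr1.
  by move/subsetP/(_ _ (model_in x)); rewrite inE hinvK model_in => /eqP.
exists (perm s_inj); last by move=> x; rewrite permE sE.
by rewrite inE; apply/'forall_forallP=> x y; rewrite !permE sD sM !eqxx.
Qed.

Definition sigma g : {perm F} :=
  odflt 1 [pick s in field_auts F | [forall x, lam g x == lam g 1 * s x]%R].

Lemma sigmaP g : g \in G0 ->
  sigma g \in field_auts F /\ forall x, lam g x = (lam g 1 * sigma g x)%R.
Proof.
move=> gG; rewrite /sigma; case: pickP => [s /andP[sF /eqfunP] // | no].
have [s sF sE] := lam_field_aut gG; have /andP[] := no s.
by split=> //; apply/eqfunP.
Qed.

Lemma sigma_eq g (s : {perm F}) : g \in G0 -> (forall x, lam g x = (lam g 1 * s x)%R) -> sigma g = s.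
Proof.
move=> gG sE; have [_ sg] := sigmaP gG; apply/permP=> x.
by apply: (mulfI (lam1_neq0 gG)); rewrite -sg -sE.
Qed.

Lemma field_autM (s : {perm F}) x y : s \in field_auts F -> s (x * y)%R = (s x * s y)%R.
Proof. by rewrite inE => /'forall_forallP/(_ x y)/andP[_ /eqP]. Qed.

Lemma sigmaM : {in G0 &, {morph sigma : g k / g * k}}.
Proof.
move=> g k gG kG; apply: sigma_eq; rewrite ?groupM // => x.
have [_ sg] := sigmaP gG; have [kF sk] := sigmaP kG.
by rewrite permM !lamM // (sk (lam g x)) (sk (lam g 1%R)) sg field_autM // mulrA.
Qed.

Canonical sigma_morphism := Morphism sigmaM.

(** An element with trivial field automorphism is a multiplication, hence commutes with [A], which
    is its own centraliser. *)
Lemma ker_sigma : 'ker sigma = A.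
Proof.
apply/setP=> g; apply/idP/idP=> [gK|gA].
  have gG : g \in G0 := subsetP (subsetIl _ _) g gK.
  have s1 : sigma g = 1 := mker gK; rewrite -CA inE gG; apply/centP=> a aA.
  have aG := subsetP sAG a aA; have [_ sg] := sigmaP gG.
  apply: lam_ffull; rewrite ?groupM // => x; rewrite !lamM // !(lamA _ aA).
  by rewrite sg [in RHS]sg s1 !perm1 mulrCA.
have gG := subsetP sAG g gA; apply/kerP => //; apply: sigma_eq => // x.
by rewrite perm1 !lamA // mulr1.
Qed.

Lemma sigma_im : sigma @* G0 \subset field_auts F.
Proof. by apply/subsetP=> _ /morphimP[g _ gG ->]; have [] := sigmaP gG. Qed.

Lemma card_sigma_im : #|sigma @* G0| = #|G0 : A|.
Proof.
have := card_isog (first_isog sigma_morphism); rewrite /= ker_sigma => <-.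
by rewrite card_quotient ?normal_norm.
Qed.

Lemma model_quotient_cyclic : cyclic (G0 / A).
Proof.
have := isog_cyclic (first_isog sigma_morphism); rewrite /= ker_sigma => ->.
have [phi [_ aut_phi _]] := field_auts_cycle charFp cardF.
have sub : sigma @* G0 \subset <[phi]> by rewrite -aut_phi sigma_im.
exact: cyclicS sub (cycle_cyclic phi).
Qed.

Lemma model_index_dvd : #|G0 : A| %| n.
Proof.
have [phi [_ aut_phi <-]] := field_auts_cycle charFp cardF.
have sub : sigma @* G0 \subset <[phi]> by rewrite -aut_phi sigma_im.
by rewrite -card_sigma_im; apply: cardSg sub.
Qed.

Lemma sigma_surj s : #|G0 : A| = n -> s \in field_auts F ->
  exists2 g, g \in G0 & sigma g = s.
Proof.
move=> defn sF; have [phi [_ aut_phi ophi]] := field_auts_cycle charFp cardF.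
have im : sigma @* G0 = field_auts F.
  by apply/eqP; rewrite eqEcard sigma_im card_sigma_im defn aut_phi -orderE ophi /=.
by move: sF; rewrite -im => /morphimP[g _ gG ->]; exists g.
Qed.

Lemma model_c1 a : a \in A -> c a = lam a 1%R.
Proof. by move=> aA; rewrite lamA // mulr1. Qed.

Lemma model_cM : {in A &, {morph c : a b / a * b >-> (a * b)%R}}.
Proof.
move=> a b aA bA; rewrite !model_c1 ?groupM // lamM ?(subsetP sAG) // mulrC.
by rewrite lamA // model_c1.
Qed.

Lemma model_c_inj : {in A &, injective c}.
Proof.
move=> a b aA bA eab; apply: lam_ffull; rewrite ?(subsetP sAG) // => x.
by rewrite !lamA // eab.
Qed.

Lemma model_cX a k : a \in A -> c (a ^+ k) = (c a ^+ k)%R.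
Proof.
move=> aA; elim: k => [|k IHk]; last by rewrite expgS exprS model_cM ?groupX // IHk.
have [nz1 _] := hA (group1 A).
by rewrite expg0 expr0; apply: (mulfI nz1); rewrite -model_cM // mulg1 mulr1.
Qed.

(** The injective image of [A] under [c] consists of roots of unity of exponent [#|A|], and a field
    has at most [#|A|] of these. *)
Lemma model_c_root x : (x ^+ #|A| = 1)%R -> exists2 a, a \in A & c a = x.
Proof.
move=> x1; suff /imsetP[a aA ->] : x \in c @: A by exists a.
suff -> : c @: A = [set y | (y ^+ #|A| == 1)%R] by rewrite inE x1.
apply/eqP; rewrite eqEcard card_in_imset; last exact: model_c_inj.
apply/andP; split.
  apply/subsetP=> _ /imsetP[a aA ->]; rewrite inE -model_cX // expg_cardG //.
  by rewrite -(expg0 a) model_cX.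
rewrite cardE; apply: max_unity_roots; rewrite ?enum_uniq //.
by apply/allP=> y; rewrite mem_enum inE unity_rootE.
Qed.

Lemma model_card_dvd : #|A| %| #|F|.-1.
Proof.
have [a defA] := cyclicP cycA; have aA : a \in A by rewrite defA cycle_id.
have -> : #|A| = #[a] by rewrite defA.
rewrite order_dvdn; apply/eqP/model_c_inj; rewrite ?groupX //.
rewrite model_cX // expf_card_pred; last by have [] := hA aA.
by rewrite -(expg0 a) model_cX.
Qed.

(** The generators of [A] share one normal closure in [G0], so they lie in the classes of [a] and
    [a^-1]. Each class has [#|G0 : A|] elements, as the centraliser of [a] is [A]. *)
Lemma model_totient : totient #|A| <= 2 * #|G0 : A|.
Proof.
have [a defA] := cyclicP cycA; have aA : a \in A by rewrite defA cycle_id.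
have aG := subsetP sAG a aA.
have cardcl b : 'C_G0[b] = 'C_G0[a] -> #|b ^: G0| = #|G0 : A|.
  by move=> Cb; rewrite -index_cent1 Cb -cent_cycle -defA CA.
have -> : #|A| = #[a] by rewrite defA.
rewrite totient_gen mul2n -addnn.
rewrite -{1}(cardcl a) // -(cardcl a^-1); last by rewrite -!cent_cycle cycleV.
apply: leq_trans (leq_card_setU _ _); apply: subset_leq_card.
apply/subsetP=> b; rewrite inE /generator => /eqP eab.
have bA : b \in A by rewrite defA eab cycle_id.
have bG := subsetP sAG b bA.
rewrite inE; apply/orP/mpG => //.
have sub x y : <[x]> = <[y]> -> x \in <<y ^: G0>>.
  by move=> exy; rewrite (subsetP (_ : <[y]> \subset _)) // -?exy ?cycle_id // exy cycle_subG mem_nclosure.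
by apply: nclosure_eq; apply: sub.
Qed.

Lemma model_cardVD1 : #|V^#| = #|F|.-1.
Proof. by rewrite -im_h -cardsT -(card_imset _ h_inj) im_h (cardsD1 1 V) group1. Qed.

(** [V^#] is the union of the classes of [h 1] and its inverse, which have equal size dividing
    [#|G0|] and are either equal or disjoint. *)
Lemma model_dvd2 : #|F|.-1 %| 2 * #|G0|.
Proof.
have v1 : h 1%R \in V^# by rewrite !inE model_eq1 oner_eq0 model_in.
pose C := h 1%R ^: G0; pose D := (h 1%R)^-1 ^: G0.
have cardC : #|C| %| #|G0| by rewrite -index_cent1 dvdn_indexg.
have cardD : #|D| = #|C| by rewrite /D classVg card_invg.
have CV : C \subset V^# by rewrite class_sub_norm // normD1.
have DV : D \subset V^#.
  by rewrite class_sub_norm ?normD1 // !inE groupV eq_invg1 -in_setD1.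
have VCD : V^# = C :|: D.
  apply/eqP; rewrite eqEsubset subUset CV DV !andbT; apply/subsetP=> x xV.
  by rewrite inE; apply/orP/pmtr.
rewrite -model_cardVD1 VCD.
have [e | ne] := eqVneq C D; first by rewrite -e setUid dvdn_mull.
rewrite cardsU cardD (_ : C :&: D = set0) ?cards0 ?subn0 ?addnn -?mul2n ?dvdn_mul //.
apply/setP=> x; rewrite !inE; apply: contraNF ne => /andP[/class_eqP eC /class_eqP eD].
by rewrite /C /D -eC -eD.
Qed.

(** Inversion on [V] is realised inside [G0]: it is trivial for [p = 2], and for [#|A|] even the
    scalar -1 comes from [A]. *)
Lemma model_conj : (p == 2) || ~~ odd #|A| -> {in V^# &, forall x y, x \in y ^: G0}.
Proof.
move=> H x y xV yV; suff Vy : y^-1 \in y ^: G0.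
  by case: (pmtr xV yV) => //; rewrite -(class_eqP Vy).
have [/eqP p2 | oddA] := orP H.
  have [z ->] : exists z, y = h z.
    by have := subsetP (subsetDl V 1) y yV; rewrite -im_h => /imsetP[z _ ->]; exists z.
  rewrite -modelN oppr_pchar2 ?class_refl //; first by rewrite -p2.
have [|a aA ca] := @model_c_root (-1)%R; first by rewrite -signr_odd (negPf oddA).
have [z ->] : exists z, y = h z.
  by have := subsetP (subsetDl V 1) y yV; rewrite -im_h => /imsetP[z _ ->]; exists z.
rewrite -modelN -mulN1r -ca; have [_ <-] := hA aA.
by rewrite memJ_class // (subsetP sAG).
Qed.

Lemma model_dvd1 : (p == 2) || ~~ odd #|A| -> #|F|.-1 %| #|G0|.
Proof.
move/model_conj=> conjV; have v1 : h 1%R \in V^# by rewrite !inE model_eq1 oner_eq0 model_in.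
rewrite -model_cardVD1 (_ : V^# = h 1%R ^: G0) -?index_cent1 ?dvdn_indexg //.
apply/eqP; rewrite eqEsubset class_sub_norm ?normD1 // v1 andbT.
by apply/subsetP=> x xV; apply: conjV.
Qed.

Lemma model_candidates : (p, n, #|A|, #|G0 : A|) \in candidates.
Proof.
have n_gt0 : 0 < n by case: n cardF (finNzRing_gt1 F) => // ->.
have dvd_e := model_index_dvd.
apply: candidatesP; rewrite -?cardF ?Lagrange //.
- apply: totient_le2; first exact: indexg_gt0.
  rewrite -card_quotient ?normal_norm //.
  exact: MP_cyclic_totient (MP_quotient nsAG mpG) model_quotient_cyclic.
- exact: model_card_dvd.
- exact: model_totient.
- exact: model_dvd2.
- exact: model_dvd1.
Qed.

Lemma model_stab v : (p == 2) || ~~ odd #|A| -> v \in V^# ->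
  (#|'C_G0[v]| * #|F|.-1)%N = #|G0|.
Proof.
move/model_conj=> conjV vV; have /setD1P[ntv vV'] := vV.
rewrite -(Lagrange (subsetIl G0 'C[v])) index_cent1 -model_cardVD1; congr (_ * _)%N.
apply/eq_card/subset_eqP; rewrite class_sub_norm ?normD1 // vV andbT.
by apply/subsetP=> x xV; apply: conjV.
Qed.

Lemma model_semiregular1 : #|G0 : A| = 1%N -> semiregular V G0.
Proof.
move=> e1 g; have -> : G0 :=: A by apply/eqP; rewrite eqEsubset sAG -indexg_eq1 e1 eqxx.
case/setD1P=> ntg gA; apply/trivgP/subsetP=> v /setIP[vV /cent1P cvg].
rewrite -(model_invK vV); apply/set1gP/eqP; rewrite model_eq1; apply: contraNT ntg => nz.
have gG := subsetP sAG g gA; apply/eqP/lam_ffull => // x.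
have fixv : lam g (model_inv v) = model_inv v.
  by apply: h_inj; rewrite -lamE // model_invK //; apply/conjg_fixP/commgP.
have -> : lam 1 x = x by apply: h_inj; rewrite -lamE // conjg1.
rewrite lamA // (_ : c g = 1%R) ?mul1r //.
by apply: (mulIf nz); rewrite -lamA // fixv mul1r.
Qed.

Lemma model_semiregular2 : (p == 2) || ~~ odd #|A| -> #|G0| = #|F|.-1 -> semiregular V G0.
Proof.
move=> H cardG g /setD1P[ntg gG]; apply/trivgP/subsetP=> v /setIP[vV /cent1P cvg].
apply: contraNT ntg => /set1gP/eqP ntv; have vV1 : v \in V^# by rewrite !inE ntv.
suff C1 : 'C_G0[v] = 1.
  by apply/eqP/set1gP; rewrite -C1 inE gG; apply/cent1P/commute_sym.
have q_gt0 : 0 < #|F|.-1 by rewrite -model_cardVD1 card_gt0; apply/set0Pn; exists v.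
apply/eqP; rewrite trivg_card1 -(eqn_pmul2r q_gt0) mul1n.
by rewrite (model_stab H vV1) cardG.
Qed.

(** With index [n] every field automorphism is induced by [G0], so Frobenius has a lift [g]. *)
Lemma model_frobenius : #|G0 : A| = n -> exists g b,
  [/\ g \in G0, b != 0%R, forall x, lam g x = (b * x ^+ p)%R & #[sigma g] = n].
Proof.
move=> en; have [phi [phiX aut_phi ophi]] := field_auts_cycle charFp cardF.
have [|g gG eg] := sigma_surj en (_ : phi \in _); first by rewrite aut_phi cycle_id.
have [_ lg] := sigmaP gG; exists g, (lam g 1%R).
split=> // [|x|]; rewrite ?lam1_neq0 ?eg // lg eg.
by rewrite -[phi]expg1 phiX expn1.
Qed.

Lemma model_stab1 k : k \in G0 -> lam k 1%R = 1%R -> k \in 'C_G0[h 1%R].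
Proof.
move=> kG k1; rewrite inE kG; apply/cent1P/commute_sym/commgP/conjg_fixP.
by rewrite lamE // k1.
Qed.

(* If g acts as x |-> b * x ^ p then g ^ 2 has coefficient b ^ (p + 1), which
   here lies in the image of A; so x |-> x ^ (p ^ 2) belongs to G0. *)
Lemma model_square : #|G0 : A| = n -> (p.+1 * #|A|)%N = #|F|.-1 ->
  n %| 2 * #|'C_G0[h 1%R]|.
Proof.
move=> en cardA; have [g [b [gG nzb lg og]]] := model_frobenius en.
have [|a aA ca] := @model_c_root (b ^+ p.+1)^-1%R.
  by rewrite exprVn -exprM cardA expf_card_pred ?invr1.
have aG := subsetP sAG a aA.
have kC : g ^+ 2 * a \in 'C_G0[h 1%R].
  apply: model_stab1; rewrite ?groupM ?groupX // expg2 !lamM ?groupM // lamA // !lg.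
  by rewrite expr1n mulr1 -exprS ca mulVf // expf_neq0.
have kG : g ^+ 2 * a \in G0 by rewrite groupM ?groupX.
have sa : sigma a = 1 by apply: mker; rewrite ker_sigma.
have sk : sigma (g ^+ 2 * a) = sigma g ^+ 2.
  by rewrite sigmaM ?groupX // sa mulg1 (morphX sigma_morphism).
rewrite -og order_dvdn expgM -sk -(morphX sigma_morphism) //.
by rewrite expg_cardG // morph1.
Qed.

Lemma model_c_eq1 a : a \in A -> (c a == 1%R) = (a == 1).
Proof.
move=> aA; have c1 : c 1 = 1%R by rewrite -(expg0 a) model_cX // expr0.
by rewrite -c1 (inj_in_eq model_c_inj).
Qed.

Lemma mem_ker_sigma g : g \in G0 -> (g \in A) = (sigma g == 1).
Proof.
move=> gG; apply/idP/eqP => [|s1]; first by rewrite -ker_sigma => /mker.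
by rewrite -ker_sigma; apply/kerP.
Qed.

(* In order 25 the candidate G0 is C3 : C8, where g and g ^ 3 generate the same
   subgroup of order 8, but the conjugates of g lie in g * C3. *)
Lemma model_not25 : p = 5 -> n = 2 -> #|A| = 12 -> #|G0 : A| = 2 -> False.
Proof.
move=> p5 n2 cardA e2; have q24 : #|F|.-1 = 24 by rewrite cardF p5 n2.
have cardG : #|G0| = 24 by rewrite -(Lagrange sAG) cardA e2.
have C1 : 'C_G0[h 1%R] = 1.
  apply/eqP; rewrite trivg_card1 -(eqn_pmul2r (isT : 0 < 24)) -{1}q24 mul1n.
  rewrite model_stab ?cardA ?orbT ?cardG //.
  by rewrite !inE model_eq1 oner_eq0 model_in.
have [|g [b [gG nzb lg og]]] := model_frobenius; first by rewrite e2 n2.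
rewrite p5 in lg; rewrite n2 in og.
have b24 : (b ^+ 24 = 1)%R by rewrite -q24 expf_card_pred.
have gA : g \notin A by rewrite mem_ker_sigma // -order_eq1 og.
(* Otherwise [A] contains multiplication by the inverse of [b], and the corrected [g * a] fixes 1,
   against the trivial stabiliser. *)
have b12 : (b ^+ 12 != 1)%R.
  apply: contra gA => /eqP b1; have [|a aA ca] := @model_c_root b^-1%R.
    by rewrite cardA exprVn b1 invr1.
  have aG := subsetP sAG a aA.
  have : g * a \in 'C_G0[h 1%R].
    apply: model_stab1; rewrite ?groupM // lamM // lamA // lg.
    by rewrite expr1n mulr1 ca mulVf.
  by rewrite C1 => /set1gP/eqP; rewrite mulg_eq1 => /eqP->; rewrite groupV.
have g2A : g ^+ 2 \in A.
  by rewrite mem_ker_sigma ?groupX // (morphX sigma_morphism) // -og expg_order.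
have cg2 : c (g ^+ 2) = (b ^+ 6)%R.
  by rewrite model_c1 // expg2 lamM // !lg expr1n mulr1 -exprS.
have cgX k : c (g ^+ (2 * k)) = (b ^+ (6 * k))%R.
  by rewrite expgM model_cX // cg2 exprM.
have g8 : g ^+ 8 = 1.
  apply/eqP; rewrite -(model_c_eq1 (_ : g ^+ (2 * 4) \in A)); last by rewrite expgM groupX.
  by rewrite cgX b24.
have g12 : g ^+ 12 != 1.
  rewrite -(model_c_eq1 (_ : g ^+ (2 * 6) \in A)); last by rewrite expgM groupX.
  by rewrite cgX (exprD b 24 12) b24 mul1r.
(* [A] has index 2, so [g ^ k] is already a conjugate [g ^ a] with [a] in [A]. Then [g^-1 * g ^ a]
   is multiplication by the inverse of [c a ^+ 4], and [c a ^+ 12 = 1]. *)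
have cube k : k \in G0 -> (g^-1 * g ^ k) ^+ 3 = 1.
  move=> kG; have [a aA ->] : exists2 a, a \in A & g ^ k = g ^ a.
    have [kA | nkA] := boolP (k \in A); first by exists k.
    have gkA : g^-1 * k \in A by apply: index2_divl sAG e2 _ _ _ _.
    by exists (g^-1 * k) => //; rewrite conjgM (_ : g ^ g^-1 = g) // conjgE mulgV mulg1 invgK.
  have aG := subsetP sAG a aA.
  have uA : g^-1 * g ^ a \in A.
    rewrite -commgEl commgEr groupM // memJ_norm ?groupV //.
    exact: subsetP (normal_norm nsAG) g gG.
  have eu : a * (g * (g^-1 * g ^ a)) = g * a by rewrite mulVKg conjgE mulVKg.
  have uG := subsetP sAG _ uA; have /= := congr1 (fun z => lam z 1%R) eu.
  rewrite (lamM _ aG (groupM gG uG)) (lamM _ gG uG) (lamM _ gG aG).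
  rewrite (lamA _ uA) !(lamA _ aA) !lg mulr1 expr1n mulr1 => cu.
  have [nza _] := hA aA.
  have cu4 : (c (g^-1 * g ^ a) * c a ^+ 4 = 1)%R.
    apply: (mulIf (mulf_neq0 nza nzb)); rewrite mul1r -[RHS]cu [in RHS]exprSr.
    by rewrite -[LHS]mulrA; congr (_ * _)%R; rewrite [RHS]mulrC -[RHS]mulrA.
  apply/eqP; rewrite -model_c_eq1 ?groupX // model_cX //.
  have := congr1 (fun z => z ^+ 3)%R cu4; rewrite exprMn -exprM expr1n.
  by rewrite -(model_cX 12 aA) -cardA expg_cardG // (eqP (_ : c 1 == 1)%R) ?mulr1 ?model_c_eq1 // => ->.
(* If [g ^+ 3] is conjugate to [g], then [cube] gives [g ^+ 6 = 1]; if to [g^-1], it gives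
   [g ^+ 12 = 1]. Both contradict [g12]. *)
have g9 : (g ^+ 3) ^+ 3 = g by rewrite -expgM (expgS g 8) g8 mulg1.
have /(mpG (groupX 3 gG) gG) : <<(g ^+ 3) ^: G0>> = <<g ^: G0>>.
  apply: nclosure_eq; first by rewrite groupX ?mem_nclosure.
  by rewrite -{1}g9 groupX ?mem_nclosure.
case=> /imsetP[k kG e3]; have g3 := cube k kG; case/eqP: g12.
  by rewrite (expgM g 6 2) (expgM g 2 3) -{1}(mulKg g (g ^+ 2)) -expgS e3 g3 expg1n.
have e4 : g^-1 * g ^ k = (g ^+ 4)^-1.
  by rewrite -[g ^ k]invgK -conjVg -e3 -invMg -expgSr.
by apply/eqP; rewrite -invg_eq1 (expgM g 4 3) -expgVn -e4 g3.
Qed.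

(** * From [G0] to [G]: deciding the Magnus property and identifying the group *)

Variable G : {group gT}.
Hypotheses (defG : V ><| G0 = G) (minV : minnormal V G) (abV : abelian V).

Lemma model_MP : semiregular V G0 -> MP G.
Proof.
move=> regG; apply: (MP_semiregular defG) => // x y xV yV.
have [_ sG0G _ _ _] := sdprod_context defG.
by case: (pmtr xV yV) => /(subsetP (imsetS _ sG0G)); auto.
Qed.

(** Let [x] of order [m] fix [h 1]. If [m != p], then [x * h 1] has order [m * p]. If [m = p = 2],
    choose [w] in [V] not commuting with [x]: then [x * w] cannot have order 2, since two
    involutions with an involution as product commute. *)
Lemma model_not_MP m : (p == 2) || ~~ odd #|A| -> prime m ->
  m %| #|'C_G0[h 1%R]| -> (p == 2) || (m != p) -> ~ MP G.
Proof.
move=> H m_pr mC pm; have [x /setIP[xG /cent1P cx] ox] := Cauchy m_pr mC.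
have [nsVG sG0G eG _ tiVG] := sdprod_context defG.
have ntx : x != 1 by rewrite -order_gt1 ox prime_gt1.
have ncx : x \notin 'C(V).
  apply: contra ntx => cV; apply/eqP/set1gP; rewrite -ffulG inE xG.
  exact: cV.
have xGG := subsetP sG0G x xG; have sVG := normal_sub nsVG.
have notMP w : w \in V -> #[x * w] != #[x] -> ~ MP G.
  by move=> wV; apply: (not_MP_order (V := V)).
have oV w : w \in V -> w != 1 -> #[w] = p.
  move=> wV ntw; apply: nt_prime_order => //; rewrite -(model_invK wV) -modelX.
  by rewrite -mulr_natr (pcharf0 charFp) mulr0 model0.
have nt1 : h 1%R != 1 by rewrite model_eq1 oner_eq0.
have [emp | nmp] := eqVneq m p; last first.
  apply: (notMP (h 1%R)); rewrite ?model_in // orderM ?ox.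
  - by rewrite oV ?model_in // -[X in _ != X]muln1 eqn_pmul2l ?prime_gt0 // neq_ltn orbC prime_gt1.
  - exact: commute_sym.
  by rewrite oV ?model_in // prime_coprime // dvdn_prime2.
rewrite emp eqxx orbF in pm; have p2 : p = 2 := eqP pm.
have [w wV nw] : exists2 w, w \in V & [~ x, w] != 1.
  apply/exists_inP; apply: contraR ncx => /exists_inPn nx.
  by apply/centP=> w wV; apply/commgP; apply: negbNE (nx w wV).
apply: (notMP w) => //; apply: contraNneq nw; rewrite ox emp p2 => o2.
have [-> | ntw] := eqVneq w 1; first by rewrite commg1.
have inv2 (y : gT) : #[y] = 2 -> y^-1 = y.
  by move=> oy; apply/eqP; rewrite eq_invg_mul -expg2 -oy expg_order.
rewrite commgEl (inv2 x) ?ox ?emp // conjgE inv2 ?oV ?p2 //.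
by have := expg_order (x * w); rewrite o2 expg2 !mulgA => ->.
Qed.

Lemma model_card : #|G| = (#|F| * #|G0|)%N.
Proof. by rewrite -(sdprod_card defG) -im_h card_imset // cardsT. Qed.

Lemma model_affine_isog (P : {set {perm F}}) :
  (forall q : {perm F}, q \in P <->
     exists2 g, g \in G0 & exists b, forall x, q x = (lam g x + b)%R) ->
  G \isog <<P>>.
Proof.
move=> memP; apply: (affine_isog defG ffulG h_inj im_h) => q.
split=> [/memP[g gG [b qE]] | [g gG [v vV qE]]]; last apply/memP; exists g => //.
  by exists (h b); rewrite ?model_in // => x; rewrite qE hD lamE.
exists (model_inv v) => x; apply: h_inj.
by rewrite qE hD lamE // model_invK.
Qed.

Lemma model_lam_surj x : #|A| = #|F|.-1 -> x != 0%R -> exists2 a, a \in A & c a = x.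
Proof. by move=> cardA nzx; apply: model_c_root; rewrite cardA expf_card_pred. Qed.

Lemma model_AGL1 : #|A| = #|F|.-1 -> #|G0 : A| = 1%N -> G \isog AGL1 F.
Proof.
move=> cardA e1; apply: model_affine_isog => q; rewrite inE.
have eG0 : G0 :=: A by apply/eqP; rewrite eqEsubset sAG -indexg_eq1 e1 eqxx.
split=> [/existsP[a /existsP[b /andP[nza /eqfunP qE]]] | [g gG [b qE]]].
  have [g gA cg] := model_lam_surj cardA nza; exists g; first exact: subsetP gA.
  by exists b => x; rewrite qE lamA // cg.
rewrite eG0 in gG; have [nz _] := hA gG; apply/existsP; exists (c g).
by apply/existsP; exists b; rewrite nz; apply/eqfunP=> x; rewrite qE lamA.
Qed.

Lemma model_AGammaL1 : #|A| = #|F|.-1 -> #|G0 : A| = n -> G \isog AGammaL1 F.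
Proof.
move=> cardA en; apply: model_affine_isog => q; rewrite inE; split.
  case/existsP=> a /existsP[b /exists_inP[s sF /andP[nza /eqfunP qE]]].
  have [g gG eg] := sigma_surj en sF; have [_ lg] := sigmaP gG.
  have nz1 := lam1_neq0 gG.
  have [|k kA ck] := @model_lam_surj (a / lam g 1%R)%R cardA.
    by rewrite mulf_neq0 ?invr_eq0.
  have kG := subsetP sAG k kA; exists (g * k); first exact: groupM.
  by exists b => x; rewrite qE lamM // lamA // lg eg ck mulrA divfK.
case=> g gG [b qE]; have [sF lg] := sigmaP gG.
apply/existsP; exists (lam g 1%R); apply/existsP; exists b.
apply/exists_inP; exists (sigma g) => //; rewrite lam1_neq0 //.
by apply/eqfunP=> x; rewrite qE lg.
Qed.

Lemma model_eqA : #|G0 : A| = 1%N -> G0 :=: A.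
Proof. by move=> e1; apply/eqP; rewrite eqEsubset sAG -indexg_eq1 e1 eqxx. Qed.

Lemma model_cardV : #|V| = #|F|.
Proof. by rewrite -im_h card_imset // cardsT. Qed.

Lemma model_im (X : finType) (k : X -> F) :
  injective k -> #|X| = #|F| -> [set h (k x) | x in setT] = V.
Proof.
move=> k_inj cardX; apply/eqP; rewrite eqEcard card_imset; last exact: inj_comp.
rewrite cardsT model_cardV cardX leqnn andbT.
by apply/subsetP=> _ /imsetP[x _ ->]; apply: model_in.
Qed.

Lemma model_C7semiC3 : p = 7 -> n = 1%N -> #|A| = 3 -> #|G0 : A| = 1%N ->
  G \isog C7semiC3.
Proof.
move=> p7 n1 cardA e1; have ch7 : 7 \in [pchar F]%R by rewrite -p7.
pose r := @Fp_emb F 7; pose k i := h (r i).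
have cardF7 : #|F| = #|'F_7| by rewrite cardF p7 n1 card_Fp.
have k_inj : injective k by move=> i j /h_inj/(Fp_emb_inj ch7).
have im_k : k @: setT = V by apply: model_im => //; apply: Fp_emb_inj ch7.
have r_surj x : exists i, r i = x.
  have := model_in x; rewrite -im_k => /imsetP[i _ /h_inj->].
  by exists i.
apply: (affine_isog defG ffulG k_inj im_k) => q; rewrite inE; split.
  case/existsP=> a /existsP[b /andP[/eqP a3 /eqfunP qE]].
  have [|g gA cg] := @model_c_root (r a).
    by rewrite cardA -(Fp_embX ch7) a3 Fp_emb1.
  exists g; first exact: subsetP gA.
  exists (k b) => [|x]; first exact: model_in.
  rewrite qE /k /r (Fp_embD ch7) (Fp_embM ch7) hD; congr (_ * _).
  by have [_ ->] := hA gA; rewrite cg.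
case=> g; rewrite (model_eqA e1) => gA [v vV qE].
have [a ra] := r_surj (c g); have [b rb] := r_surj (model_inv v).
apply/existsP; exists a; apply/existsP; exists b; apply/andP; split.
  apply/eqP/(Fp_emb_inj ch7); rewrite (Fp_embX ch7) Fp_emb1 [Fp_emb F a]ra.
  rewrite -model_cX // -cardA expg_cardG //.
  by apply/eqP; rewrite model_c_eq1.
apply/eqfunP=> x; apply: k_inj; rewrite qE /k /r (Fp_embD ch7) (Fp_embM ch7).
rewrite -/(r a) -/(r b) ra rb hD model_invK //.
by have [_ ->] := hA gA.
Qed.

Lemma model_S3 : #|F| = 3 -> #|G0| = 2 -> G \isog [set: 'S_3].
Proof.
move=> cardF3 cardG; have cardX : #|'I_3| = #|F| by rewrite card_ord.
pose k (i : 'I_3) := h (enum_val (cast_ord (esym cardF3) i)).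
have k_inj : injective k by move=> i j /h_inj/enum_val_inj/cast_ord_inj.
have im_k : k @: setT = V.
  by apply: model_im => // i j /enum_val_inj/cast_ord_inj.
by apply: (isog_Sym defG ffulG k_inj im_k); rewrite model_card cardF3 cardG card_ord.
Qed.

Lemma model_A4 : #|F| = 4 -> #|A| = 3 -> #|G0 : A| = 1%N -> G \isog 'Alt_('I_4).
Proof.
move=> cardF4 cardA e1; have cardX : #|'I_4| = #|F| by rewrite card_ord.
have cardG : #|G0| = 3 by rewrite (model_eqA e1).
pose k (i : 'I_4) := h (enum_val (cast_ord (esym cardF4) i)).
have k_inj : injective k by move=> i j /h_inj/enum_val_inj/cast_ord_inj.
have im_k : k @: setT = V.
  by apply: model_im => // i j /enum_val_inj/cast_ord_inj.
apply: (isog_Alt defG ffulG k_inj im_k).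
- by rewrite card_ord.
- by rewrite model_card cardF4 cardG card_ord.
- by rewrite cardG.
have [_ sG0G eG _ _] := sdprod_context defG.
have [a aA nta] : exists2 a, a \in A & a != 1.
  by apply/trivgPn; rewrite -cardG_gt1 cardA.
have nz : (c a - 1 != 0)%R by rewrite subr_eq0 model_c_eq1.
apply/subsetP=> v vV; have aG : a \in G by rewrite (subsetP sG0G) ?(subsetP sAG).
(* The commutator [[~ h y, a]] is [h ((c a - 1) * y)], so this [y] exhibits [v] as a commutator. *)
pose y := (model_inv v / (c a - 1))%R; have yG : h y \in G.
  by rewrite -eG -[h y]mulg1 mem_mulg ?model_in.
have -> : v = [~ h y, a].
  rewrite commgEl; have [_ ->] := hA aA; rewrite -modelN -hD addrC -[X in (_ - X)%R]mul1r.
  by rewrite -mulrBl mulrC divfK // model_invK.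
exact: mem_commg.
Qed.

Lemma model_M9 : p = 3 -> n = 2 -> #|A| = 4 -> #|G0 : A| = 2 -> G \isog M9.
Proof.
move=> p3 n2 cardA e2; have ch3 : 3 \in [pchar F]%R by rewrite -p3.
have q8 : #|F|.-1 = 8 by rewrite cardF p3 n2.
have cardG : #|G0| = 8 by rewrite -(Lagrange sAG) cardA e2.
have C1 : 'C_G0[h 1%R] = 1.
  apply/eqP; rewrite trivg_card1 -(eqn_pmul2r (isT : 0 < 8)) -{1}q8 mul1n.
  rewrite model_stab ?cardA ?orbT ?cardG //.
  by rewrite !inE model_eq1 oner_eq0 model_in.
have [a0 defA] := cyclicP cycA; have a0A : a0 \in A by rewrite defA cycle_id.
have a0G := subsetP sAG a0 a0A; have oa0 : #[a0] = 4 by rewrite orderE -defA.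
pose i := c a0; have ciX k : c (a0 ^+ k) = (i ^+ k)%R by rewrite model_cX.
have i2 : (i ^+ 2 = -1)%R.
  have : ((i ^+ 2 - 1) * (i ^+ 2 + 1) == 0)%R.
    have a4 : a0 ^+ 4 = 1 by rewrite -oa0 expg_order.
    by rewrite -subr_sqr -exprM -ciX a4 expr1n subr_eq0 model_c_eq1.
  rewrite mulf_eq0 subr_eq0 -ciX model_c_eq1 ?groupX // -order_dvdn oa0 /=.
  by rewrite addr_eq0 => /eqP.
have [|g [b [gG nzb lg og]]] := model_frobenius; first by rewrite e2 n2.
rewrite p3 in lg; rewrite n2 in og.
have gA : g \notin A by rewrite mem_ker_sigma // -order_eq1 og.
have b8 : (b ^+ 8 = 1)%R by rewrite -q8 expf_card_pred.
(* If [b ^+ 4] were 1, then [A] could cancel the coefficient of [g], giving an element outside [A]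
   that fixes 1. *)
have b4 : (b ^+ 4 = -1)%R.
  have : ((b ^+ 4 - 1) * (b ^+ 4 + 1) == 0)%R.
    by rewrite -subr_sqr -exprM b8 expr1n subrr.
  rewrite mulf_eq0 subr_eq0 addr_eq0 => /orP[/eqP b1 | /eqP //].
  case/negP: gA; have [|a aA ca] := @model_c_root b^-1%R.
    by rewrite cardA exprVn b1 invr1.
  have aG := subsetP sAG a aA.
  have : g * a \in 'C_G0[h 1%R].
    apply: model_stab1; rewrite ?groupM // lamM // lamA // lg.
    by rewrite expr1n mulr1 ca mulVf.
  by rewrite C1 => /set1gP/eqP; rewrite mulg_eq1 => /eqP->; rewrite groupV.
have three0 : (1 + 1 + 1 = 0 :> F)%R.
  by have := pcharf0 ch3; rewrite !mulrS mulr0n addr0 addrA.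
(* The square of [1 + i] is [2 * i], so the fourth power is -4, which is -1 in characteristic 3.
   Hence [(1 + i) / b] is a fourth root of unity, and [A] adjusts [g] to the map [j] of
   [col_emb_j]. *)
have i4 : ((1 + i) ^+ 4 = -1)%R.
  rewrite (exprM _ 2 2) sqrrD expr1n mul1r i2 addrAC subrr add0r.
  rewrite -mulr_natl exprMn i2 mulrN1; congr (- _)%R.
  apply/eqP; rewrite -subr_eq0 -natrX -(natrB _ (isT : 1 <= 2 ^ 2)) /=.
  by rewrite (pcharf0 ch3).
have [|a1 a1A ca1] := @model_c_root ((1 + i) / b)%R.
  by rewrite cardA exprMn exprVn i4 b4 invrN invr1 mulrNN mulr1.
have a1G := subsetP sAG a1 a1A; pose j := g * a1.
have jG : j \in G0 by rewrite groupM.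
have lj x : lam j x = ((1 + i) * x ^+ 3)%R.
  by rewrite lamM // lamA // lg ca1 mulrA divfK.
have jA : j \notin A by rewrite groupMr.
pose k w := h (col_emb i w).
have k_inj : injective k by move=> v w /h_inj/(col_emb_inj ch3 i2).
have im_k : k @: setT = V.
  apply: model_im; first exact: col_emb_inj.
  by rewrite card_mx card_Fp // cardF p3 n2.
have kD v w : k (v + w)%R = k v * k w by rewrite /k (col_embD _ ch3) hD.
have kI m w : k (Q8i ^+ m *m w)%R = k w ^ (a0 ^+ m).
  elim: m w => [|m IHm] w; first by rewrite expr0 mul1mx conjg1.
  rewrite exprSr -mulmxE -mulmxA IHm expgS conjgM; congr (_ ^ _).
  by rewrite /k (col_emb_i ch3 i2); have [_ ->] := hA a0A.
have kJ m w : k (Q8j ^+ m *m w)%R = k w ^ (j ^+ m).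
  elim: m w => [|m IHm] w; first by rewrite expr0 mul1mx conjg1.
  rewrite exprSr -mulmxE -mulmxA IHm expgS conjgM; congr (_ ^ _).
  by rewrite /k (col_emb_j ch3 i2) lamE // lj.
have kQ m l w : k (Q8i ^+ m * Q8j ^+ l *m w)%R = k w ^ (j ^+ l * a0 ^+ m).
  by rewrite -mulmxE -mulmxA kI kJ conjgM.
apply: (affine_isog defG ffulG k_inj im_k) => q; rewrite inE; split.
  case/exists_inP=> _ /imset2P[m l _ _ ->] /existsP[t /eqfunP qE].
  exists (j ^+ l * a0 ^+ m); first by rewrite groupM ?groupX.
  by exists (k t) => [|w]; rewrite ?model_in // qE kD kQ.
case=> y yG [v vV qE].
have [t et] : exists t, k t = v by move: vV; rewrite -im_k => /imsetP[t _ ->]; exists t.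
(* [G0] consists of the cosets [A] and [j *: A]. The order of the factors is opposite to that in
   [Q8set], because conjugation acts on the right. *)
have [m [l ey]] : exists (m : 'I_4) (l : 'I_2), y = j ^+ l * a0 ^+ m.
  have powA x : x \in A -> exists m : 'I_4, x = a0 ^+ m.
    rewrite defA => /cyclePmin[m ltm ->]; rewrite oa0 in ltm.
    by exists (Ordinal ltm).
  have [yA | nyA] := boolP (y \in A).
    have [m ->] := powA y yA; exists m, ord0.
    by rewrite expg0 mul1g.
  have [m em] := powA _ (index2_divl sAG e2 jG yG jA nyA); exists m, ord_max.
  by rewrite expg1 -em mulVKg.
apply/exists_inP; exists (Q8i ^+ m * Q8j ^+ l)%R; first exact: imset2_f.
apply/existsP; exists t; apply/eqfunP=> w; apply: k_inj.
by rewrite qE kD kQ ey et.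
Qed.

Lemma model_card_stab m : (p == 2) || ~~ odd #|A| ->
  (m * #|F|.-1)%N = (#|A| * #|G0 : A|)%N -> #|'C_G0[h 1%R]| = m.
Proof.
move=> H em; have v1 : h 1%R \in V^# by rewrite !inE model_eq1 oner_eq0 model_in.
have q_gt0 : 0 < #|F|.-1 by rewrite -model_cardVD1 card_gt0; apply/set0Pn; exists (h 1%R).
apply/eqP; rewrite -(eqn_pmul2r q_gt0) em (Lagrange sAG).
by rewrite model_stab.
Qed.

Lemma model_isog_Zp m : prime m -> #|G| = m -> G \isog Zp m.
Proof.
move=> m_pr cardG; rewrite isog_cyclic_card ?prime_cyclic ?cardG //.
  by rewrite card_Zp ?prime_gt0 /=.
by rewrite card_Zp ?prime_gt0.
Qed.

(** The cases follow the order of [candidates]. [MP G] comes from semiregularity of [G0] on [V], its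
    failure from an element of prime order in the stabiliser of [h 1]. *)
Lemma model_classification :
  (MP G ->
     (G \isog Zp 2 \/ G \isog Zp 3 \/ G \isog [set: 'S_3] \/ G \isog 'Alt_('I_4) \/
      isog_AGL1 G 5 \/ G \isog C7semiC3 \/ isog_AGL1 G 7 \/ G \isog M9))
  /\
  (~ MP G ->
     (isog_AGammaL1 G 4 \/ isog_AGammaL1 G 8 \/ isog_AGammaL1 G 9 \/
      isog_AGammaL1 G 16)).
Proof.
have cand := model_candidates; have cardG0 := Lagrange sAG.
have regMP (P Q : Prop) : semiregular V G0 -> P -> (MP G -> P) /\ (~ MP G -> Q).
  by move=> /model_MP mp hP; split=> // /(_ mp).
have notMP (P Q : Prop) : ~ MP G -> Q -> (MP G -> P) /\ (~ MP G -> Q).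
  by move=> nmp hQ; split=> // /nmp.
have aGL : #|A| = #|F|.-1 -> #|G0 : A| = 1%N -> forall q, #|F| = q -> isog_AGL1 G q.
  by move=> cA e1 q cF; exists F; split=> //; apply: model_AGL1.
have aGaL : #|A| = #|F|.-1 -> #|G0 : A| = n -> forall q, #|F| = q -> isog_AGammaL1 G q.
  by move=> cA en q cF; exists F; split=> //; apply: model_AGammaL1.
have cG := model_card; have reg1 := model_semiregular1.
rewrite -cardG0 in cG.
move: cand; rewrite /candidates.
case/predU1P=> [[p2 n1 cA e1] | ].
  apply: regMP; [exact: reg1 | left; apply: model_isog_Zp => //].
  by rewrite cG cA e1 cardF p2 n1.
case/predU1P=> [[p2 n2 cA e1] | ].
  apply: regMP; [exact: reg1 | do 3!right; left; apply: model_A4 => //].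
  by rewrite cardF p2 n2.
case/predU1P=> [[p2 n2 cA e2] | ].
  have cF : #|F| = 4 by rewrite cardF p2 n2.
  apply: notMP; last by left; apply: aGaL; rewrite ?cA ?cF ?e2 ?n2.
  apply: (model_not_MP (m := 2)); rewrite ?p2 //.
  by rewrite (model_card_stab (m := 2)) ?p2 // cA e2 cF.
case/predU1P=> [[p2 n3 cA e3] | ].
  have cF : #|F| = 8 by rewrite cardF p2 n3.
  apply: notMP; last by right; left; apply: aGaL; rewrite ?cA ?cF ?e3 ?n3.
  apply: (model_not_MP (m := 3)); rewrite ?p2 //.
  by rewrite (model_card_stab (m := 3)) ?p2 // cA e3 cF.
case/predU1P=> [[p2 n4 cA e4] | ].
  have cF : #|F| = 16 by rewrite cardF p2 n4.
  apply: notMP; last by do 3!right; apply: aGaL; rewrite ?cA ?cF ?e4 ?n4.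
  apply: (model_not_MP (m := 2)); rewrite ?p2 //.
  by rewrite (model_card_stab (m := 4)) ?p2 // cA e4 cF.
case/predU1P=> [[p2 n6 cA e6] | ].
  have cF : #|F| = 64 by rewrite cardF p2 n6.
  (* The stabiliser has order 126 / 63 = 2, and 6 does not divide 4. *)
  have := model_square; rewrite e6 n6 cA p2 cF => /(_ erefl erefl).
  by rewrite (model_card_stab (m := 2)) ?p2 // cA e6 cF.
case/predU1P=> [[p3 n1 cA e1] | ].
  apply: regMP; [exact: reg1 | right; left; apply: model_isog_Zp => //].
  by rewrite cG cA e1 cardF p3 n1.
case/predU1P=> [[p3 n1 cA e1] | ].
  apply: regMP; [exact: reg1 | do 2!right; left; apply: model_S3].
    by rewrite cardF p3 n1.
  by rewrite -cardG0 cA e1.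
case/predU1P=> [[p3 n2 cA e2] | ].
  apply: regMP; last by do 7!right; apply: model_M9.
  by apply: model_semiregular2; rewrite ?cA ?orbT // -cardG0 cA e2 cardF p3 n2.
case/predU1P=> [[p3 n2 cA e2] | ].
  have cF : #|F| = 9 by rewrite cardF p3 n2.
  apply: notMP; last by do 2!right; left; apply: aGaL; rewrite ?cA ?cF ?e2 ?n2.
  apply: (model_not_MP (m := 2)); rewrite ?cA ?p3 //.
  by rewrite (model_card_stab (m := 2)) ?cA ?orbT // e2 cF.
case/predU1P=> [[p3 n4 cA e4] | ].
  have cF : #|F| = 81 by rewrite cardF p3 n4.
  (* The stabiliser is trivial here, and 4 does not divide 2. *)
  have := model_square; rewrite e4 n4 cA p3 cF => /(_ erefl erefl).
  by rewrite (model_card_stab (m := 1)) ?cA ?orbT // e4 cF.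
case/predU1P=> [[p5 n1 cA e1] | ].
  have cF : #|F| = 5 by rewrite cardF p5 n1.
  by apply: regMP; [exact: reg1 | do 4!right; left; apply: aGL; rewrite ?cA ?cF].
case/predU1P=> [[p5 n2 cA e2] | ].
  by case: model_not25.
case/predU1P=> [[p7 n1 cA e1] | ].
  by apply: regMP; [exact: reg1 | do 5!right; left; apply: model_C7semiC3].
case/predU1P=> [[p7 n1 cA e1] | //].
have cF : #|F| = 7 by rewrite cardF p7 n1.
by apply: regMP; [exact: reg1 | do 6!right; left; apply: aGL; rewrite ?cA ?cF].
Qed.

End SemilinearModel.

(* By Dedekind, 'C_G(V) = V * ('C_G(V) :&: M) for a core-free maximal M, and
   'C_G(V) :&: M is normalised by V * M = G. *)
Lemma primitive_faithful (gT : finGroupType) (G V G0 : {group gT}) :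
  primitive_group G -> V ><| G0 = G -> abelian V -> V :!=: 1 -> 'C_G0(V) = 1.
Proof.
move=> [M [maxM coreM]] defG abV ntV.
have [nsVG sG0G eG nVG tiVG] := sdprod_context defG; have [sVG nVGG] := andP nsVG.
have sMG := maxgroupp maxM; have {}sMG : M \subset G by case/andP: sMG.
have nVM : ~~ (V \subset M).
  apply: contra ntV => sVM; rewrite -subG1 -coreM.
  exact: gcore_max.
have [_ maxM'] := maxgroupP maxM.
have MV : M * V = G.
  rewrite -norm_joinEl ?(subset_trans sMG) //; apply/eqP; apply: contraR nVM => neq.
  rewrite -(maxM' (M <*> V)%G) ?joing_subl ?joing_subr //.
  by rewrite properEneq neq join_subG sMG.
pose D := 'C_M(V).
have D1 : D :=: 1.
  apply/trivgP; rewrite -coreM; apply: gcore_max; first exact: subsetIl.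
  rewrite -MV mul_subG //; first by rewrite normsI ?normG // norms_cent // (subset_trans sMG).
  by rewrite cents_norm // centsC subsetIr.
have CV : 'C_G(V) = V.
  by rewrite -MV setIC -group_modr // setIC -/D D1 mul1g.
apply/trivgP; rewrite -tiVG subsetI subsetIl andbT -{2}CV.
exact: setSI.
Qed.

Theorem theorem1p3 (gT : finGroupType) (G V G0 : {group gT}) :
  primitive_group G ->
  V ><| G0 = G ->
  (exists p, prime p /\ p.-abelem V) ->
  acts_irreducibly G0 V 'J ->
  MP G0 ->
  (forall x y, x \in V^# -> y \in V^# -> x \in y ^: G \/ x \in y^-1 ^: G) ->
  (MP G ->
     (G \isog Zp 2 \/ G \isog Zp 3 \/ G \isog [set: 'S_3] \/ G \isog 'Alt_('I_4) \/
      isog_AGL1 G 5 \/ G \isog C7semiC3 \/ isog_AGL1 G 7 \/ G \isog M9))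
  /\
  (~ MP G ->
     (isog_AGammaL1 G 4 \/ isog_AGammaL1 G 8 \/ isog_AGammaL1 G 9 \/
      isog_AGammaL1 G 16)).
Proof.
move=> primG defG [p [p_pr abelV]] irrG mpG0 pmV.
have abV := abelem_abelian abelV.
have [nsVG sG0G eG nVG tiVG] := sdprod_context defG; have [sVG nVGG] := andP nsVG.
have [/andP[ntV _] minV0] := mingroupP irrG.
have minV : minnormal V G.
  apply/mingroupP; rewrite ntV; split=> // H /andP[ntH nHG] sHV.
  by apply: minV0 => //; rewrite ntH /= astabsJ (subset_trans sG0G).
have ffulG := primitive_faithful primG defG abV ntV.
(* The abelian group [V] acts trivially on itself, so the hypothesis on [G]-classes passes to
   [G0]. *)
have classV y : y \in V -> y ^: G = y ^: G0.
  move=> yV; apply/eqP; rewrite eqEsubset; apply/andP; split; last exact: imsetS.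
  apply/subsetP=> _ /imsetP[k kG ->]; move: kG; rewrite -eG => /mulsgP[v g vV gG ->].
  rewrite conjgM (_ : y ^ v = y) ?memJ_class //.
  by apply/conjg_fixP/commgP; apply: (centsP abV).
have pmtr : {in V^# &, forall x y, x \in y ^: G0 \/ x \in y^-1 ^: G0}.
  move=> x y xV yV; have /setD1P[_ yV'] := yV.
  by rewrite -!classV ?groupV //; apply: pmV.
have [A [nsAG cycA CA]] : exists A : {group gT}, [/\ A <| G0, cyclic A & 'C_G0(A) = A].
  apply: MP_selfcentralizing => // A nsAG abA.
  exact: (abelian_normal_cyclic nVG abelV ffulG pmtr nsAG ntV abA).
have irrA := selfcent_irreducible nVG ffulG pmtr nsAG cycA CA.
have nVA := subset_trans (normal_sub nsAG) nVG.
have [F [h [c [h_inj im_h hD hA]]]] := cyclic_field_model abelV ntV nVA cycA irrA.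
have [n cardV] := p_natP (abelem_pgroup abelV).
have cardF : #|F| = (p ^ n)%N by rewrite -cardV -im_h card_imset // cardsT.
exact: (model_classification p_pr cardF nVG ffulG pmtr nsAG cycA CA irrA h_inj im_h
          hD hA mpG0 defG minV abV).
Qed.
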